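(* Let $K\subset\mathbb{R}^n$ be a closed set whose complement $K^c$ is a bounded open set, let $\mu\in(0,1]$ and $\alpha,\lambda>0$ with $r_\mu^\alpha(K)>\alpha+\lambda$, and assume $(K^{\oplus\alpha})^c$ is connected with finite geodesic diameter $\mathrm{Gdiam}((K^{\oplus\alpha})^c)<\infty$. Then $\mathrm{ax}_\lambda^\alpha(K)$ is a geodesic space with finite geodesic diameter. More precisely, for any $x,x'\in\mathrm{ax}_\lambda^\alpha(K)$ there exists a path $\gamma:[0,1]\to\mathrm{ax}_\lambda^\alpha(K)$ of minimal length with $\gamma(0)=x$, $\gamma(1)=x'$; its length is the geodesic distance between $x$ and $x'$ in $\mathrm{ax}_\lambda^\alpha(K)$, and $$\mathrm{length}(\gamma)\le\mathrm{Gdiam}(\mathrm{ax}_\lambda^\alpha(K))\le 2\frac{R_{\max}}{\tilde\mu^2}+\mathrm{Gdiam}\big((K^{\oplus\alpha})^c\big)\,e^{\frac{R_{\max}}{\alpha\tilde\mu^2}},$$ where $R_{\max}=R_{\max}(K)$ and $\tilde\mu=\tilde\mu_{\mu,\lambda}^{\alpha,\alpha}(K)$.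
   Context: For a closed set $K\subset\mathbb{R}^n$ with bounded open complement: $R_K(x)=d(x,K)$; $\Theta_K(x)=\{y\in K:\|x-y\|=R_K(x)\}$; for bounded $S$, $\mathrm{center}(S)$ and $\mathrm{radius}(S)$ are the center and radius of the smallest ball enclosing $S$; $\mathcal F_K(x)=\mathrm{radius}(\Theta_K(x))$; for $x\notin K$, $\nabla_K(x)=(x-\mathrm{center}(\Theta_K(x)))/R_K(x)$. $R_{\max}(K)=\max_{x\in K^c}R_K(x)$. Critical function: $\chi_K(t)=\inf\{\|\nabla_K(x)\|:R_K(x)=t\}$ for $t\in(0,R_{\max}(K)]$ (infimum of empty set $=1$). $K^{\oplus\alpha}=\{x:d(x,K)\le\alpha\}$. For $\mu\in(0,1]$, $\alpha\ge0$: $r_\mu^\alpha(K)=\inf\{t>\alpha:\chi_K(t)<\mu\}$. $\mathrm{ax}_\lambda^\alpha(K)=\{x:\mathcal F_{K^{\oplus\alpha}}(x)\ge\lambda\}$. $\tilde\mu_{\mu,\lambda}^{\alpha,\alpha'}(K)=\min\big(\mu,\sqrt{1-(\lambda/(r_\mu^{\alpha'}(K)-\alpha))^2}\big)$. For $A\subset\mathbb{R}^n$, $d_A(x,y)$ is the infimum of lengths of rectifiable paths in $A$ from $x$ to $y$, and $\mathrm{Gdiam}(A)=\sup_{x,y\in A}d_A(x,y)$. *)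

(* Defs.v *)
From mathcomp Require Import all_boot all_order all_algebra.
From mathcomp Require Import all_classical all_reals all_analysis.
Set Implicit Arguments. Unset Strict Implicit. Unset Printing Implicit Defensive.
Import Order.TTheory GRing.Theory Num.Theory.
Local Open Scope classical_set_scope.
Local Open Scope ring_scope.

Section Medial.
Variables (R : realType) (n : nat).
Notation V := 'rV[R]_n.

Definition enorm (x : V) : R := Num.sqrt (\sum_(i < n) (x ord0 i) ^+ 2).
Definition edist (x y : V) : R := enorm (x - y).

Definition eclosed (K : set V) : Prop :=
  forall x, (forall e : R, 0 < e -> exists2 y, K y & edist x y < e) -> K x.
Definition eopen (U : set V) : Prop :=
  forall x, U x -> exists2 e : R, 0 < e & forall y, edist x y < e -> U y.
Definition ebounded (A : set V) : Prop :=
  exists M : R, forall x, A x -> enorm x <= M.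
Definition econnected (A : set V) : Prop :=
  forall U W : set V, eopen U -> eopen W -> A `<=` U `|` W ->
    A `&` U `&` W = set0 -> A `&` U !=set0 -> A `&` W !=set0 -> False.

Definition dist_set (K : set V) (x : V) : R := inf [set edist x y | y in K].
Definition Theta (K : set V) (x : V) : set V :=
  [set y | K y /\ edist x y = dist_set K x].
Definition radius (S : set V) : R :=
  inf [set r : R | 0 <= r /\ exists c : V, forall y, S y -> edist c y <= r].
Definition center (S : set V) : V :=
  xget 0 [set c : V | forall y, S y -> edist c y <= radius S].
Definition FK (K : set V) (x : V) : R := radius (Theta K x).
(* nabla_K(x), for x not in K *)
Definition gradK (K : set V) (x : V) : V :=
  (dist_set K x)^-1 *: (x - center (Theta K x)).
Definition Rmax (K : set V) : R := sup [set dist_set K x | x in ~` K].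
Definition chi (K : set V) (t : R) : R :=
  let S := [set enorm (gradK K x) | x in [set x | dist_set K x = t]] in
  if pselect (S !=set0) then inf S else 1.
Definition offset (K : set V) (alpha : R) : set V :=
  [set x | dist_set K x <= alpha].
(* r_mu^alpha(K) in the extended reals (inf of empty set = +oo) *)
Definition rmu (K : set V) (mu alpha : R) : \bar R :=
  ereal_inf [set t%:E | t in [set t : R | alpha < t /\ chi K t < mu]].
Definition ax (K : set V) (lambda alpha : R) : set V :=
  [set x | lambda <= FK (offset K alpha) x].
(* mu tilde_{mu,lambda}^{alpha,alpha'}(K); when r = +oo the square-root term is 1 *)
Definition mutilde (K : set V) (mu lambda alpha alpha' : R) : R :=
  match rmu K mu alpha' with
  | EFin r => Num.min mu (Num.sqrt (1 - (lambda / (r - alpha)) ^+ 2))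
  | _ => mu
  end.

Definition is_path (A : set V) (g : R -> V) (x y : V) : Prop :=
  g 0 = x /\ g 1 = y /\
  (forall t, 0 <= t <= 1 -> A (g t)) /\
  (forall t, 0 <= t <= 1 -> forall e : R, 0 < e -> exists2 d : R, 0 < d &
      forall s, 0 <= s <= 1 -> `|s - t| < d -> edist (g s) (g t) < e).
Definition partition_sums (g : R -> V) : set R :=
  [set s | exists (k : nat) (t : nat -> R),
     [/\ t 0%N = 0, t k = 1, (forall i, (i < k)%N -> t i <= t i.+1) &
         s = \sum_(i < k) edist (g (t i.+1)) (g (t i))]].
Definition plength (g : R -> V) : \bar R :=
  ereal_sup [set s%:E | s in partition_sums g].
Definition gdist (A : set V) (x y : V) : \bar R :=
  ereal_inf [set plength g | g in [set g | is_path A g x y]].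
Definition Gdiam (A : set V) : \bar R :=
  ereal_sup [set gdist A x y | x in A & y in A].

End Medial.

(* Main.v *)
(* Push a path of the complement of the offset [A = offset K alpha] into the
   lambda-medial axis along the gradient flow of the distance function.  Before
   reaching the axis, the flow raises the distance at rate at least [mt ^ 2], so it
   arrives within time [T = Rm / mt ^ 2]; it has speed at most 1 and, since the
   distance to [K] is [1 / alpha]-semiconcave outside [A], it expands lengths by at
   most [expR (T / alpha)].  Two flow lines and the pushed path join any two points
   of the axis.

   The flow is discretized by the implicit Euler scheme
   [y = argmax (dist_set A z - |z - x| ^ 2 / (2 h))].  The radius [FK A] jumps across
   the medial axis, so an explicit scheme would zigzag around it without ever meeting
   it, whereas [FK A] is exactly nondecreasing along the implicit one: the points
   [x] with [l <= FK A x] are those having a supergradient [eta] of half the squared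
   distance such that [l ^ 2 <= dist_set A x ^ 2 - |eta| ^ 2].  This also shows that
   the axis is closed.  The scheme produces finite chains of points of the axis with
   arbitrarily small steps; Arzela-Ascoli turns them into paths, and turns minimizing
   sequences of paths into a shortest one. *)
Require Import Defs.
From mathcomp Require Import all_boot all_order all_algebra.
From mathcomp Require Import all_classical all_reals all_analysis.
From mathcomp Require Import ring lra.
(* [all_analysis] exports another [edist]. *)
Import Defs.
Set Implicit Arguments. Unset Strict Implicit. Unset Printing Implicit Defensive.
Import Order.TTheory GRing.Theory Num.Theory.
Import numFieldNormedType.Exports.
Local Open Scope classical_set_scope.
Local Open Scope ring_scope.

(** * The Euclidean inner product and norm *)

Section Euclidean.
Variables (R : realType) (n : nat).
Implicit Types (x y z v w : 'rV[R]_n) (a b : R).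

Definition dot x y : R := \sum_(i < n) x ord0 i * y ord0 i.

Lemma dotC x y : dot x y = dot y x.
Proof. by apply: eq_bigr => i _; rewrite mulrC. Qed.

Lemma dotDl x y z : dot (x + y) z = dot x z + dot y z.
Proof. by rewrite -big_split; apply: eq_bigr => i _; rewrite mxE mulrDl. Qed.

Lemma dotZl a x y : dot (a *: x) y = a * dot x y.
Proof. by rewrite mulr_sumr; apply: eq_bigr => i _; rewrite mxE mulrA. Qed.

Lemma dotNl x y : dot (- x) y = - dot x y.
Proof. by rewrite -scaleN1r dotZl mulN1r. Qed.

Lemma dotBl x y z : dot (x - y) z = dot x z - dot y z.
Proof. by rewrite dotDl dotNl. Qed.

Lemma dotDr x y z : dot z (x + y) = dot z x + dot z y.
Proof. by rewrite dotC dotDl !(dotC z). Qed.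

Lemma dotZr a x y : dot y (a *: x) = a * dot y x.
Proof. by rewrite dotC dotZl (dotC y). Qed.

Lemma dotNr x y : dot y (- x) = - dot y x.
Proof. by rewrite dotC dotNl (dotC y). Qed.

Definition dotE := (dotDl, dotDr, dotNl, dotNr, dotZl, dotZr).

Lemma dot_ge0 x : 0 <= dot x x.
Proof. by apply: sumr_ge0 => i _; rewrite -expr2 sqr_ge0. Qed.

Lemma enorm_ge0 x : 0 <= enorm x.
Proof. exact: sqrtr_ge0. Qed.

Lemma enorm_sqr x : enorm x ^+ 2 = dot x x.
Proof.
rewrite /enorm (eq_bigr (fun i => x ord0 i * x ord0 i)); first exact/sqr_sqrtr/dot_ge0.
by move=> i _; rewrite expr2.
Qed.

(** Cauchy-Schwarz: expand the square of [enorm y *: x - enorm x *: y] and divide by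
    [enorm x * enorm y]; if this product vanishes, one of the vectors is zero. *)
Lemma dot_le_enorm x y : dot x y <= enorm x * enorm y.
Proof.
have hx := enorm_ge0 x; have hy := enorm_ge0 y.
have := dot_ge0 (enorm y *: x - enorm x *: y).
rewrite !dotE (dotC y x) -!enorm_sqr => h.
have [/eqP|xy0] := eqVneq (enorm x * enorm y) 0; last first.
  have pxy : 0 < enorm x * enorm y by rewrite lt_def xy0 mulr_ge0.
  by rewrite -(ler_pM2l pxy); lra.
have dot0 u v : enorm u = 0 -> dot u v = 0.
  move=> u0; apply: big1 => i _; suff -> : u ord0 i = 0 by rewrite mul0r.
  move: (enorm_sqr u); rewrite u0 expr0n /= => /esym /eqP.
  rewrite psumr_eq0 => [/allP /(_ i)|j _]; last by rewrite -expr2 sqr_ge0.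
  by rewrite mem_index_enum => /(_ isT); rewrite mulf_eq0 orbb => /eqP.
rewrite mulf_eq0 => /orP[] /eqP h0; first by rewrite (dot0 x) // h0 mul0r.
by rewrite dotC (dot0 y) // h0 mulr0.
Qed.

Lemma enorm_sqrD x y : enorm (x + y) ^+ 2 = enorm x ^+ 2 + 2 * dot x y + enorm y ^+ 2.
Proof. by rewrite !enorm_sqr !dotE (dotC y x); lra. Qed.

Lemma enormN x : enorm (- x) = enorm x.
Proof. by rewrite /enorm; congr Num.sqrt; apply: eq_bigr => i _; rewrite mxE sqrrN. Qed.

Lemma enormD x y : enorm (x + y) <= enorm x + enorm y.
Proof.
rewrite -(@ler_pXn2r _ 2) ?nnegrE ?addr_ge0 ?enorm_ge0 //.
by rewrite enorm_sqrD sqrrD; have := dot_le_enorm x y; lra.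
Qed.

Lemma enormZ a x : 0 <= a -> enorm (a *: x) = a * enorm x.
Proof.
move=> a0; apply/eqP; rewrite -(@eqrXn2 _ 2) ?mulr_ge0 ?enorm_ge0 //.
by rewrite exprMn !enorm_sqr !dotE expr2 mulrA.
Qed.

Lemma enorm0 : enorm (0 : 'rV[R]_n) = 0.
Proof. by rewrite -(scale0r 0) enormZ // mul0r. Qed.

Lemma enorm_eq0 x : enorm x = 0 -> x = 0.
Proof.
move=> x0; apply/rowP => i; rewrite mxE.
move: (enorm_sqr x); rewrite x0 expr0n /= => /esym /eqP.
rewrite psumr_eq0 => [/allP /(_ i)|j _]; last by rewrite -expr2 sqr_ge0.
by rewrite mem_index_enum => /(_ isT); rewrite mulf_eq0 orbb => /eqP.
Qed.

Lemma coord_le_enorm x i : `|x ord0 i| <= enorm x.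
Proof.
rewrite -(@ler_pXn2r _ 2) ?nnegrE ?enorm_ge0 // enorm_sqr real_normK ?num_real //.
rewrite /dot (bigD1 i) //= expr2 lerDl; apply: sumr_ge0 => j _.
by rewrite -expr2 sqr_ge0.
Qed.

Lemma edist_ge0 x y : 0 <= edist x y.
Proof. exact: enorm_ge0. Qed.

Lemma edistC x y : edist x y = edist y x.
Proof. by rewrite /edist -opprB enormN. Qed.

Lemma edist0 x : edist x x = 0.
Proof. by rewrite /edist subrr enorm0. Qed.

Lemma edist_triangle y x z : edist x z <= edist x y + edist y z.
Proof. by apply: le_trans (enormD _ _); rewrite addrA subrK. Qed.

Lemma edist_eq0 x y : edist x y = 0 -> x = y.
Proof. by move/enorm_eq0/eqP; rewrite subr_eq0 => /eqP. Qed.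

End Euclidean.

(** * Limits along an ultrafilter on the natural numbers *)

Lemma nat_ultrafilter : exists U : set_system nat, UltraFilter U /\ \oo `<=` U.
Proof. exact: ultraFilterLemma. Qed.

(* Limits along one fixed ultrafilter replace all extractions of convergent subsequences. *)
Definition omega : set_system nat := projT1 (cid nat_ultrafilter).

#[global] Instance omega_ultra : UltraFilter omega.
Proof. exact: (projT2 (cid nat_ultrafilter)).1. Qed.

Lemma cofinite_omega : \oo `<=` omega.
Proof. exact: (projT2 (cid nat_ultrafilter)).2. Qed.

Section OmegaLimits.
Variable R : realType.
Implicit Types (u v : nat -> R) (l a b : R).

Lemma cvg_omega u l : u @ \oo --> l -> u @ omega --> l.
Proof. by move=> ul A /ul /cofinite_omega. Qed.

Lemma harmonic_omega : (fun k => k.+1%:R^-1 : R) @ omega --> (0 : R).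
Proof. exact/cvg_omega/cvg_harmonic. Qed.

(** The segment is compact, so the image ultrafilter has a cluster point in it, and an ultrafilter
    converges to each of its cluster points. *)
Lemma bounded_cvg_omega u a b : (forall k, a <= u k <= b) -> exists l, u @ omega --> l.
Proof.
move=> ub; have : (u @ omega) [set` `[a, b]].
  by apply: (@filterE _ omega) => k; rewrite /= in_itv ub.
move=> /(@segment_compact R a b _ _)[l [_ clul]]; exists l => B Bl.
have [//|nB] := in_ultra_setVsetC (u @^-1` B) omega_ultra.
have [x [nBx Bx]] := clul (~` B) B nB Bl.
by case: nBx.
Qed.

Lemma le_lim_omega u v a b : u @ omega --> a -> v @ omega --> b ->
  (forall k, u k <= v k) -> a <= b.
Proof. by move=> ua vb uv; apply: ler_cvg_to ua vb _; apply: filterE. Qed.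

End OmegaLimits.

Section VectorLimits.
Variables (R : realType) (n : nat).
Implicit Types (u v : nat -> 'rV[R]_n) (l m : 'rV[R]_n).

Definition vcvg u l := forall i, (fun k => u k ord0 i) @ omega --> l ord0 i.

Lemma bounded_vcvg u (M : R) : (forall k, enorm (u k) <= M) -> exists l, vcvg u l.
Proof.
move=> uM; have h i : exists l : R, (fun k => u k ord0 i) @ omega --> l.
  apply: (@bounded_cvg_omega _ _ (- M) M) => k.
  by rewrite -ler_norml (le_trans (coord_le_enorm _ _)).
exists (\row_i projT1 (cid (h i))) => i; rewrite mxE.
exact: projT2 (cid (h i)).
Qed.

Lemma vcvg_cst l : vcvg (fun=> l) l.
Proof. by move=> i; exact: cvg_cst. Qed.
Arguments vcvg_cst : clear implicits.

Lemma vcvgD u v l m : vcvg u l -> vcvg v m -> vcvg (fun k => u k + v k) (l + m).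
Proof.
by move=> ul vm i; rewrite mxE; under eq_fun do rewrite mxE; apply: cvgD.
Qed.

Lemma vcvgZ (a : nat -> R) (b : R) u l : a @ omega --> b -> vcvg u l ->
  vcvg (fun k => a k *: u k) (b *: l).
Proof.
by move=> ab ul i; rewrite mxE; under eq_fun do rewrite mxE; apply: cvgM.
Qed.

Lemma vcvgB u v l m : vcvg u l -> vcvg v m -> vcvg (fun k => u k - v k) (l - m).
Proof.
by move=> ul vm i; rewrite !mxE; under eq_fun do rewrite !mxE; apply: cvgB.
Qed.

Lemma cvg_dot u v l m : vcvg u l -> vcvg v m ->
  (fun k => dot (u k) (v k)) @ omega --> dot l m.
Proof.
move=> ul vm; rewrite /dot.
apply: cvg_big => [|i _]; [exact: add_continuous|exact: cvgM].
Qed.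

Lemma cvg_enorm u l : vcvg u l -> (fun k => enorm (u k)) @ omega --> enorm l.
Proof.
move=> ul; have enE (x : 'rV[R]_n) : enorm x = Num.sqrt (dot x x).
  by rewrite -enorm_sqr sqrtr_sqr ger0_norm ?enorm_ge0.
under eq_fun do rewrite enE; rewrite enE.
by apply: continuous_cvg (cvg_dot ul ul); apply: sqrt_continuous.
Qed.

Lemma cvg_edist u v l m : vcvg u l -> vcvg v m ->
  (fun k => edist (u k) (v k)) @ omega --> edist l m.
Proof. by move=> ul vm; apply/cvg_enorm/vcvgB. Qed.

Lemma vcvg_edist u l : (fun k => edist (u k) l) @ omega --> (0 : R) -> vcvg u l.
Proof.
move=> ul i; apply/cvgrPdist_lt => e e0.
have h : \forall k \near omega, `|edist (u k) l| < e by exact: cvgr0_norm_lt.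
apply: filterS h => k; rewrite /= ger0_norm ?edist_ge0 //.
apply: le_lt_trans; rewrite edistC; have := coord_le_enorm (l - u k) i.
by rewrite !mxE.
Qed.

Lemma eclosed_vcvg (A : set 'rV[R]_n) u l : eclosed A -> vcvg u l ->
  (forall k, A (u k)) -> A l.
Proof.
move=> cA ul uA; apply: cA => e e0.
have lu : (fun k => edist l (u k)) @ omega --> (0 : R).
  by rewrite -(edist0 l); apply: cvg_edist ul; exact: vcvg_cst.
have : \forall k \near omega, `|edist l (u k)| < e by exact: cvgr0_norm_lt.
by move=> /filter_ex[k]; rewrite ger0_norm ?edist_ge0 // => h; exists (u k).
Qed.

End VectorLimits.

(** Serves second-order expansions divided by [e], whose leftover error is of order [e]. [C] may
    have any sign; were [b < a], the case [e = 1] would make it positive. *)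
Lemma ler_of_addeps (R : realFieldType) (C a b : R) :
  (forall e, 0 < e -> e <= 1 -> a <= b + e * C) -> a <= b.
Proof.
move=> h; rewrite leNgt; apply/negP => ba.
have C0 : 0 < C by have := h 1 ltr01 (lexx _); lra.
pose e := Num.min 1 ((a - b) / (2 * C)).
have e0 : 0 < e by rewrite lt_min ltr01 divr_gt0 ?subr_gt0 ?mulr_gt0.
have eC : e * C <= (a - b) / 2.
  by rewrite -ler_pdivlMr // -mulrA -invfM ge_min lexx orbT.
have e1 : e <= 1 by rewrite ge_min lexx.
by have := h e e0 e1; lra.
Qed.

(** * The distance to a closed set and the supergradients of half its square *)

Section DistanceFunction.
Variables (R : realType) (n : nat) (A : set 'rV[R]_n).
Hypotheses (cA : eclosed A) (A0 : A !=set0).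
Implicit Types (x y z p v eta : 'rV[R]_n).

Lemma dist_set_le x p : A p -> dist_set A x <= edist x p.
Proof.
move=> Ap; apply: ge_inf; last by exists p.
by exists 0 => _ [y _ <-]; exact: edist_ge0.
Qed.

Lemma dist_set_ge0 x : 0 <= dist_set A x.
Proof.
have [a Aa] := A0; apply: lb_le_inf; first by exists (edist x a), a.
by move=> _ [y _ <-]; exact: edist_ge0.
Qed.

(** A minimizing sequence is bounded, and its limit along [omega] stays in the closed set [A]. *)
Lemma Theta_neq0 x : exists p, Theta A x p.
Proof.
have dA e : 0 < e -> exists2 p, A p & edist x p < dist_set A x + e.
  move=> e0; have [|_ [p Ap <-] pe] := @inf_adherent _ [set edist x y | y in A] _ e0.
    split; first by have [a Aa] := A0; exists (edist x a), a.
    by exists 0 => _ [y _ <-]; exact: edist_ge0.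
  by exists p.
have h (k : nat) : exists p, A p /\ edist x p < dist_set A x + k.+1%:R^-1.
  by have [|p] := dA k.+1%:R^-1; [rewrite invr_gt0|exists p].
pose u k := projT1 (cid (h k)); have uP k := projT2 (cid (h k)).
have [l ul] : exists l, vcvg u l.
  apply: (@bounded_vcvg _ _ _ (dist_set A x + 1 + enorm x)) => k.
  have -> : u k = (u k - x) + x by rewrite subrK.
  rewrite (le_trans (enormD _ _)) // lerD2r.
  have [_ /ltW] := uP k; rewrite edistC => /le_trans; apply.
  by rewrite lerD2l invf_le1 ?ler1n.
have Al : A l by apply: eclosed_vcvg cA ul _ => k; have [] := uP k.
exists l; split=> //; apply/eqP; rewrite eq_le dist_set_le // andbT.
apply: (@le_lim_omega _ (fun k => edist x (u k)) (fun k => dist_set A x + k.+1%:R^-1)).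
- by apply: cvg_edist ul; exact: vcvg_cst.
- rewrite -[X in _ --> X]addr0; apply: cvgD; [exact: cvg_cst|exact: harmonic_omega].
- by move=> k; have [_ /ltW] := uP k.
Qed.

Lemma dist_set_lip x y : dist_set A y <= dist_set A x + edist x y.
Proof.
have [p [Ap <-]] := Theta_neq0 x; apply: le_trans (dist_set_le _ Ap) _.
by rewrite addrC (edistC x y); exact: edist_triangle.
Qed.

Lemma cvg_dist_set u x : vcvg u x ->
  (fun k => dist_set A (u k)) @ omega --> dist_set A x.
Proof.
move=> ux; have d0 : (fun k => edist x (u k)) @ omega --> (0 : R).
  by rewrite -(edist0 x); apply: cvg_edist ux; exact: vcvg_cst.
apply: (@squeeze_cvgr _ _ _ _ (fun k => dist_set A x - edist x (u k))
  (fun k => dist_set A x + edist x (u k))).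
- apply: filterE => k; rewrite dist_set_lip andbT.
  by rewrite lerBlDr edistC dist_set_lip.
- by rewrite -[X in _ --> X]subr0; apply: cvgB d0; exact: cvg_cst.
- by rewrite -[X in _ --> X]addr0; apply: cvgD d0; exact: cvg_cst.
Qed.

(* [eta] is a supergradient at [x] of half the squared distance to [A]. *)
Definition supergrad x eta := forall z,
  dist_set A z ^+ 2 <= dist_set A x ^+ 2 + 2 * dot eta (z - x) + enorm (z - x) ^+ 2.

(** Test the inequality at [x - eta], which minimizes its right-hand side; the left-hand side is
    nonnegative. *)
Lemma supergrad_enorm_le x eta : supergrad x eta -> enorm eta <= dist_set A x.
Proof.
move=> /(_ (x - eta)); have -> : x - eta - x = - eta by rewrite addrAC subrr add0r.
rewrite enormN dotNr -enorm_sqr => h.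
rewrite -(@ler_pXn2r _ 2) ?nnegrE ?enorm_ge0 ?dist_set_ge0 //.
by have := sqr_ge0 (dist_set A (x - eta)); lra.
Qed.

(** Add the two inequalities, each tested at the base point of the other. *)
Lemma supergrad_monotone x y xi eta : supergrad x xi -> supergrad y eta ->
  dot (eta - xi) (y - x) <= enorm (y - x) ^+ 2.
Proof.
move=> /(_ y) h1 /(_ x); rewrite -(opprB y x) enormN dotNr => h2.
by rewrite dotBl; lra.
Qed.

(** Concavity of [dist_set A ^ 2 - enorm ^ 2], an infimum of affine functions: a nearest point [p]
    of the intermediate point satisfies the identity for squared distances to [p], and [p] bounds
    the distances at [x] and [z] from above. *)
Lemma dist_set_convex_comb x z t : 0 <= t -> t <= 1 ->
  (1 - t) * dist_set A x ^+ 2 + t * dist_set A z ^+ 2 - t * (1 - t) * enorm (z - x) ^+ 2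
    <= dist_set A (x + t *: (z - x)) ^+ 2.
Proof.
move=> t0 t1; have [p [Ap <-]] := Theta_neq0 (x + t *: (z - x)).
have sq y : dist_set A y ^+ 2 <= enorm (y - p) ^+ 2.
  by apply: lerXn2r; rewrite ?nnegrE ?dist_set_ge0 ?enorm_ge0 //; exact: dist_set_le.
have hx := sq x; have hz := sq z.
have -> : edist (x + t *: (z - x)) p ^+ 2 = (1 - t) * enorm (x - p) ^+ 2
    + t * enorm (z - p) ^+ 2 - t * (1 - t) * enorm (z - x) ^+ 2.
  have -> : z - p = (x - p) + (z - x) by rewrite [RHS]addrC subrKA.
  have -> : edist (x + t *: (z - x)) p = enorm ((x - p) + t *: (z - x)).
    by congr enorm; rewrite addrAC.
  move: (x - p) (z - x) => a w.
  by rewrite !enorm_sqrD (enormZ _ t0) exprMn dotZr; ring.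
have : (1 - t) * dist_set A x ^+ 2 <= (1 - t) * enorm (x - p) ^+ 2.
  by apply: ler_wpM2l; rewrite ?subr_ge0.
have : t * dist_set A z ^+ 2 <= t * enorm (z - p) ^+ 2 by exact: ler_wpM2l.
lra.
Qed.

(* [dist_set A ^ 2 - enorm ^ 2] is concave, so a local bound with any constant self-improves. *)
Lemma supergrad_local x eta (C d : R) : 0 < d ->
  (forall z, enorm (z - x) <= d -> dist_set A z ^+ 2 <=
     dist_set A x ^+ 2 + 2 * dot eta (z - x) + C * enorm (z - x) ^+ 2) ->
  supergrad x eta.
Proof.
move=> d0 loc z; set w := z - x.
(* With this [M], the point at parameter [t = e / M] on the way to [z] is within [d] of [x] whenever
   [e <= 1]. *)
pose M := 1 + enorm w / d.
have M1 : 1 <= M by rewrite lerDl divr_ge0 ?enorm_ge0 ?ltW.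
have M0 : 0 < M := lt_le_trans ltr01 M1.
apply: (@ler_of_addeps _ (M^-1 * (C - 1) * enorm w ^+ 2)) => e e0 e1.
pose t := e / M.
have t0 : 0 < t by rewrite divr_gt0.
have t1 : t <= 1 by rewrite ler_pdivrMr // mul1r (le_trans e1).
have xw : x + t *: w - x = t *: w by rewrite addrAC subrr add0r.
have tw : enorm (x + t *: w - x) <= d.
  rewrite xw (enormZ _ (ltW t0)) /t mulrAC ler_pdivrMr //.
  have wM : enorm w <= d * M.
    by rewrite mulrDr mulr1 mulrCA divff ?gt_eqF // mulr1 lerDr ltW.
  apply: le_trans wM; have := ler_wpM2r (enorm_ge0 w) e1; lra.
have := dist_set_convex_comb x z (ltW t0) t1.
move/le_trans/(_ (loc _ tw)); rewrite -/w xw dotZr (enormZ _ (ltW t0)) exprMn => h.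
rewrite -(ler_pM2l t0).
have -> : e * (M^-1 * (C - 1) * enorm w ^+ 2) = t * ((C - 1) * enorm w ^+ 2).
  by rewrite /t; ring.
by lra.
Qed.

(** The inequality passes to the limit for each fixed [z]; the closedness of the axis rests on
    this. *)
Lemma supergrad_vcvg u (eta : nat -> 'rV[R]_n) x l : vcvg u x -> vcvg eta l ->
  (forall k, supergrad (u k) (eta k)) -> supergrad x l.
Proof.
move=> ux el h z.
have zu : vcvg (fun k => z - u k) (z - x) by apply: vcvgB ux; exact: vcvg_cst.
apply: (@le_lim_omega _ (fun=> dist_set A z ^+ 2) (fun k => dist_set A (u k) ^+ 2
    + 2 * dot (eta k) (z - u k) + enorm (z - u k) ^+ 2)); last by move=> k; exact: h.
  exact: cvg_cst.
have cu := cvg_dist_set ux; have en := cvg_enorm zu; have dt := cvg_dot el zu.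
rewrite !expr2; apply: cvgD; last exact: cvgM.
apply: cvgD; first exact: cvgM.
by apply: cvgM dt; exact: cvg_cst.
Qed.

(** * The smallest ball enclosing the nearest points *)

Section MinimalBall.
Variable x : 'rV[R]_n.
Let S := Theta A x.
Let r := FK A x.
Let c := center S.
Let d := dist_set A x.

Lemma radius_ge0 : 0 <= r.
Proof.
apply: lb_le_inf => [|s []//].
exists d; split; first exact: dist_set_ge0.
by exists x => y [_ yd]; rewrite yd.
Qed.

Lemma radius_le s p : 0 <= s -> (forall q, S q -> edist p q <= s) -> r <= s.
Proof.
move=> s0 h; apply: ge_inf; last by split=> //; exists p.
by exists 0 => t [].
Qed.

(** [center] is a choice operator, so it is enough that some center attains the infimum. Nearly
    optimal centers stay close to one contact point [q], hence are bounded, and their limit is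
    optimal. *)
Lemma center_le_radius p : S p -> edist c p <= r.
Proof.
move: p; suff [m mP] : exists m, forall p, S p -> edist m p <= r.
  exact: (@xgetI _ 0 [set m | forall p, S p -> edist m p <= r] m mP).
have [q Sq] := Theta_neq0 x.
have h (k : nat) : exists m, forall p, S p -> edist m p <= r + k.+1%:R^-1.
  have k0 : (0 : R) < k.+1%:R^-1 by rewrite invr_gt0.
  have [|s [s0 [m hm]] hs] := @inf_adherent _
    [set s : R | 0 <= s /\ exists m, forall y, S y -> edist m y <= s] _ k0.
    split; last by exists 0 => t [].
    exists d; split; first exact: dist_set_ge0.
    by exists x => y [_ yd]; rewrite yd.
  by exists m => p /hm /le_trans; apply; exact: ltW.
pose u k := projT1 (cid (h k)); have uP k := projT2 (cid (h k)).
have le1 (k : nat) : k.+1%:R^-1 <= 1 :> R by rewrite invf_le1 ?ler1n.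
have [l ul] : exists l, vcvg u l.
  apply: (@bounded_vcvg _ _ _ (r + 1 + enorm q)) => k.
  have -> : u k = (u k - q) + q by rewrite subrK.
  rewrite (le_trans (enormD _ _)) // lerD2r (le_trans (uP k _ Sq)) //.
  by rewrite lerD2l.
exists l => p Sp.
apply: (@le_lim_omega _ (fun k => edist (u k) p) (fun k => r + k.+1%:R^-1)).
- by apply: cvg_edist => //; exact: vcvg_cst.
- rewrite -[X in _ --> X]addr0; apply: cvgD; [exact: cvg_cst|exact: harmonic_omega].
- by move=> k; exact: uP.
Qed.

(* Moving the center by [- e *: v] cannot shrink the enclosing ball. *)
Lemma exists_far_contact v e : 0 < e -> exists2 p, S p &
  r ^+ 2 - e ^+ 2 <= enorm (p - c) ^+ 2 + 2 * e * dot (p - c) v + e ^+ 2 * enorm v ^+ 2.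
Proof.
(* Otherwise the ball about [c - e *: v] of squared radius [r ^ 2 - e ^ 2] encloses [S]. The slack
   [e ^ 2] makes it strictly smaller and is negligible after division by [e]. *)
move=> e0; apply: contrapT => hn.
have h p : S p -> edist (c - e *: v) p ^+ 2 < r ^+ 2 - e ^+ 2.
  move=> Sp; rewrite ltNge; apply/negP => hp; apply: hn; exists p => //.
  move: hp; have -> : edist (c - e *: v) p = enorm ((p - c) + e *: v).
    by rewrite /edist -enormN; congr enorm; rewrite !opprD !opprK addrC addrA.
  by rewrite enorm_sqrD (enormZ _ (ltW e0)) exprMn dotZr mulrA.
have [q Sq] := Theta_neq0 x.
have s0 : 0 < r ^+ 2 - e ^+ 2 by apply: le_lt_trans (sqr_ge0 _) (h _ Sq).
have : r <= Num.sqrt (r ^+ 2 - e ^+ 2).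
  apply: (radius_le (p := c - e *: v)) => [|p Sp]; first exact: sqrtr_ge0.
  rewrite -(@ler_pXn2r _ 2) ?nnegrE ?edist_ge0 ?sqrtr_ge0 // (sqr_sqrtr (ltW s0)).
  exact/ltW/h.
rewrite -(@ler_pXn2r _ 2) ?nnegrE ?radius_ge0 ?sqrtr_ge0 // (sqr_sqrtr (ltW s0)).
have : 0 < e ^+ 2 by rewrite exprn_gt0.
by lra.
Qed.

(** Expanding the squared distance from [x] to a contact point [p] about [c] gives Pythagoras up to
    the term [dot (p - c) (c - x)]. Far contacts in the directions [c - x] and [x - c] control this
    term from both sides, in place of the fact that the center is in the convex hull of the contact
    points. *)
Lemma FK_sqr : r ^+ 2 = d ^+ 2 - enorm (x - c) ^+ 2.
Proof.
have expand p v : S p -> v = c - x -> d ^+ 2 = enorm (p - c) ^+ 2 + 2 * dot (p - c) v + enorm v ^+ 2.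
  move=> [_ pd] ->; rewrite /d -pd -enorm_sqrD edistC; congr (enorm _ ^+ 2).
  by rewrite addrA subrK.
have le_r p : S p -> enorm (p - c) ^+ 2 <= r ^+ 2.
  move=> Sp; apply: lerXn2r; rewrite ?nnegrE ?enorm_ge0 ?radius_ge0 //.
  by have := center_le_radius Sp; rewrite edistC.
have -> : enorm (x - c) = enorm (c - x) by rewrite -enormN opprB.
set w := c - x; set W := enorm w ^+ 2.
apply/eqP; rewrite eq_le; apply/andP; split.
- apply: (@ler_of_addeps _ (1 + W)) => e e0 e1.
  have [p Sp hp] := exists_far_contact w e0.
  have dE := expand p w Sp erefl; have := le_r p Sp; rewrite -/W in dE hp *.
  set P := enorm (p - c) ^+ 2 in dE hp *; set D := dot (p - c) w in dE hp * => PR.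
  rewrite -(ler_pM2l e0).
  have : (1 - e) * P <= (1 - e) * r ^+ 2 by apply: ler_wpM2l; rewrite ?subr_ge0.
  have : e * d ^+ 2 = e * P + 2 * e * D + e * W by rewrite dE; ring.
  by move: hp; rewrite !expr2; lra.
- apply: (@ler_of_addeps _ (1 + W)) => e e0 e1.
  have [p Sp] := exists_far_contact (- w) e0.
  rewrite dotNr enormN -/W.
  have dE := expand p w Sp erefl; have := le_r p Sp; rewrite -/W in dE *.
  set P := enorm (p - c) ^+ 2 in dE *; set D := dot (p - c) w in dE * => PR hp.
  rewrite -(ler_pM2l e0).
  have : (1 + e) * P <= (1 + e) * r ^+ 2 by apply: ler_wpM2l => //; lra.
  have : e * d ^+ 2 = e * P + 2 * e * D + e * W by rewrite dE; ring.
  by move: hp; rewrite !expr2; lra.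
Qed.

(** Bound the distance at [z] by the distance to a far contact [p] in the direction [z - x]:
    replacing [x - p] by [x - c] costs [dot (p - c) (z - x)], which is nonnegative up to order
    [e]. *)
Lemma supergrad_center : supergrad x (x - c).
Proof.
move=> z; set v := z - x.
apply: (@ler_of_addeps _ (1 + enorm v ^+ 2)) => e e0 _.
have [p Sp] := exists_far_contact v e0.
have le_r : enorm (p - c) ^+ 2 <= r ^+ 2.
  apply: lerXn2r; rewrite ?nnegrE ?enorm_ge0 ?radius_ge0 //.
  by have := center_le_radius Sp; rewrite edistC.
have [Ap pd] := Sp; rewrite /d.
have : dist_set A z ^+ 2 <= edist z p ^+ 2.
  by apply: lerXn2r; rewrite ?nnegrE ?dist_set_ge0 ?edist_ge0 //; exact: dist_set_le.
have -> : edist z p ^+ 2 = dist_set A x ^+ 2 + 2 * dot (x - p) v + enorm v ^+ 2.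
  rewrite -pd -enorm_sqrD; congr (enorm _ ^+ 2).
  by rewrite /v [RHS]addrC subrKA.
have -> : x - p = (x - c) - (p - c) by rewrite opprB addrA subrK.
rewrite dotBl => h1 h2.
have {}h2 : - (e ^+ 2) <= 2 * e * dot (p - c) v + e ^+ 2 * enorm v ^+ 2 by lra.
have : - e <= 2 * dot (p - c) v + e * enorm v ^+ 2.
  by rewrite -(ler_pM2l e0); move: h2; rewrite !expr2; lra.
by lra.
Qed.

(** Move from [x] along [G = x - c]: the nearest points tend to a contact point [p] with
    [dot (x - p) G <= dot eta G]. As [p] is within [r] of [c], [FK_sqr] gives
    [enorm G ^ 2 <= dot (x - p) G], and Cauchy-Schwarz concludes. *)
Lemma center_enorm_le eta : supergrad x eta -> enorm (x - c) <= enorm eta.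
Proof.
move=> h; set G := x - c.
pose t (k : nat) : R := k.+1%:R^-1.
have t0 k : 0 < t k by rewrite invr_gt0.
have t1 k : t k <= 1 by rewrite invf_le1 ?ler1n.
have tl : t @ omega --> (0 : R) := @harmonic_omega R.
pose y k := x + t k *: G.
have yx : vcvg y x.
  rewrite -[x in vcvg _ x]addr0 -[X in x + X](scale0r G).
  by apply: vcvgD; [exact: vcvg_cst|apply: vcvgZ tl _; exact: vcvg_cst].
pose u k := projT1 (cid (Theta_neq0 (y k))).
have uP k : Theta A (y k) (u k) := projT2 (cid (Theta_neq0 (y k))).
have [p up] : exists p, vcvg u p.
  apply: (@bounded_vcvg _ _ _ (d + enorm G + enorm G + enorm x)) => k.
  have yxG : enorm (y k - x) <= enorm G.
    rewrite /y addrAC subrr add0r (enormZ _ (ltW (t0 k))) -[leRHS]mul1r.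
    by apply: ler_wpM2r; rewrite ?enorm_ge0.
  have -> : u k = (u k - y k) + (y k - x) + x by rewrite addrA !subrK.
  rewrite (le_trans (enormD _ _)) // lerD2r (le_trans (enormD _ _)) // lerD //.
  have [_] := uP k; rewrite edistC /edist => ->.
  by rewrite (le_trans (dist_set_lip x _)) // lerD2l edistC.
have Sp : S p.
  split; first by apply: eclosed_vcvg cA up _ => k; have [] := uP k.
  have h1 := cvg_edist yx up; have h2 := cvg_dist_set yx.
  apply/eqP; rewrite eq_le; apply/andP; split.
    by apply: le_lim_omega h1 h2 _ => k; have [_ ->] := uP k.
  by apply: le_lim_omega h2 h1 _ => k; have [_ ->] := uP k.
(* [u k] realizes the distance at [y k] and bounds it from above at [x]; the terms quadratic in
   [t k] cancel. *)
have upG k : dot (x - u k) G <= dot eta G.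
  have [Au yu] := uP k; have := h (y k).
  have -> : y k - x = t k *: G by rewrite /y addrAC subrr add0r.
  rewrite -yu; have -> : edist (y k) (u k) = enorm ((x - u k) + t k *: G).
    by congr enorm; rewrite addrAC.
  rewrite enorm_sqrD !dotZr.
  have : dist_set A x ^+ 2 <= edist x (u k) ^+ 2.
    by apply: lerXn2r; rewrite ?nnegrE ?dist_set_ge0 ?edist_ge0 //; exact: dist_set_le.
  rewrite /edist -/d => h1 h2; rewrite -(ler_pM2l (t0 k)); lra.
have pG : dot (x - p) G <= dot eta G.
  have xu : vcvg (fun k => x - u k) (x - p) by apply: vcvgB up; exact: vcvg_cst.
  have GG : vcvg (fun=> G) G by exact: vcvg_cst.
  by apply: le_lim_omega (cvg_dot xu GG) (cvg_cst _) upG.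
have : enorm (p - c) ^+ 2 <= r ^+ 2.
  apply: lerXn2r; rewrite ?nnegrE ?enorm_ge0 ?radius_ge0 //.
  by have := center_le_radius Sp; rewrite edistC.
rewrite FK_sqr -/G.
have -> : p - c = - (x - p) + G by rewrite opprB addrA subrK.
rewrite enorm_sqrD enormN dotNl /d.
have [_ <-] := Sp; rewrite /edist => hG.
have GG : enorm G * enorm G <= enorm eta * enorm G.
  by apply: le_trans (dot_le_enorm _ _); rewrite -expr2; lra.
have [->|G0] := eqVneq (enorm G) 0; first exact: enorm_ge0.
by move: GG; rewrite ler_pM2r // lt_def G0 enorm_ge0.
Qed.

(** Removes [radius] and [center] from the description of the axis: the right-hand side passes to
    limits and through proximal steps. One direction takes [x - c] as supergradient, the other uses
    that its norm is minimal. *)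
Lemma le_FK_supergrad (l : R) : 0 <= l ->
  l <= FK A x <-> exists2 eta, supergrad x eta & l ^+ 2 <= d ^+ 2 - enorm eta ^+ 2.
Proof.
move=> l0; rewrite -(@ler_pXn2r _ 2) ?nnegrE ?radius_ge0 // FK_sqr; split=> [h|[eta h]].
  by exists (x - c) => //; exact: supergrad_center.
move/le_trans; apply; rewrite lerD2l lerN2.
by apply: lerXn2r; rewrite ?nnegrE ?enorm_ge0 //; exact: center_enorm_le.
Qed.

End MinimalBall.
End DistanceFunction.

(** * The proximal step: existence, expansion, gain of distance and monotonicity of the radius *)

Section ProximalStep.
Variables (R : realType) (n : nat) (A : set 'rV[R]_n).
Hypotheses (cA : eclosed A) (A0 : A !=set0).
Implicit Types (x y z xi : 'rV[R]_n).

Let dA_ge0 x : 0 <= dist_set A x := dist_set_ge0 A0 x.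

(** Square the bound on the unit ball about [y], collect everything beyond first order in one
    constant, and let [supergrad_local] improve that constant. *)
Lemma supergrad_of_linear y xi (C : R) :
  (forall z, dist_set A z <= dist_set A y + dot xi (z - y) + C * enorm (z - y) ^+ 2) ->
  supergrad A y (dist_set A y *: xi).
Proof.
move=> lin; set d := dist_set A y.
(* With [D] and [W] as below, the constant gathers [2 * d * C * W] and the bound
   [2 * D ^ 2 + 2 * (C * W) ^ 2] on [(D + C * W) ^ 2], using [W <= 1]. *)
apply: (supergrad_local cA A0 (C := 2 * d * C + 2 * enorm xi ^+ 2 + 2 * C ^+ 2) ltr01).
move=> z; move: (lin z); rewrite dotZl -/d; set w := z - y => hz w1.
have W1 : enorm w ^+ 2 <= 1 by rewrite exprn_ile1 ?enorm_ge0.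
have W0 : 0 <= enorm w ^+ 2 by rewrite sqr_ge0.
have dW : dot xi w ^+ 2 <= enorm xi ^+ 2 * enorm w ^+ 2.
  rewrite -exprMn -ler_sqrt ?sqr_ge0 // !sqrtr_sqr.
  rewrite [leRHS]ger0_norm ?mulr_ge0 ?enorm_ge0 // ler_norml dot_le_enorm andbT.
  by rewrite lerNl -dotNl -[enorm xi]enormN; exact: dot_le_enorm.
set D := dot xi w in hz dW *; set W := enorm w ^+ 2 in hz dW W0 W1 *.
have : dist_set A z ^+ 2 <= (d + D + C * W) ^+ 2.
  by apply: lerXn2r => //; rewrite nnegrE // (le_trans _ hz).
have : (C * W) ^+ 2 <= C ^+ 2 * W.
  by rewrite exprMn ler_wpM2l ?sqr_ge0 // expr2 ler_piMr.
have : 0 <= (D - C * W) ^+ 2 by exact: sqr_ge0.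
by rewrite !expr2 in dW *; lra.
Qed.

(** Semiconcavity of the distance with constant [1 / a]: divide by [2 * d] after using
    [(dist_set A z - d) ^ 2 >= 0]. *)
Lemma linear_of_supergrad y xi (a : R) : 0 < a -> a <= dist_set A y ->
  supergrad A y (dist_set A y *: xi) ->
  forall z, dist_set A z <= dist_set A y + dot xi (z - y) + (2 * a)^-1 * enorm (z - y) ^+ 2.
Proof.
move=> a0 ad sg z; set d := dist_set A y in ad sg *.
have d0 : 0 < d := lt_le_trans a0 ad.
have := sg z; rewrite dotZl -/d; set w := z - y => hz.
have W0 : 0 <= enorm w ^+ 2 by rewrite sqr_ge0.
have : (2 * d)^-1 * enorm w ^+ 2 <= (2 * a)^-1 * enorm w ^+ 2.
  by rewrite ler_wpM2r // lef_pV2 ?posrE ?mulr_gt0 // ler_pM2l.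
suff : dist_set A z <= d + dot xi w + (2 * d)^-1 * enorm w ^+ 2 by lra.
have dd : (2 * d) * (2 * d)^-1 = 1 by rewrite divff // gt_eqF // mulr_gt0.
have d20 : 0 < 2 * d by rewrite mulr_gt0.
rewrite -(ler_pM2l d20) !mulrDr mulrA dd mul1r.
by have := sqr_ge0 (dist_set A z - d); rewrite !expr2 in hz *; lra.
Qed.

(* One implicit Euler step of length [h] for the gradient flow of [dist_set A]. *)
Definition prox_step (h : R) x y := dist_set A x <= dist_set A y /\
  supergrad A y (dist_set A y *: (h^-1 *: (y - x))).

(** The distance is 1-Lipschitz, so a maximizing sequence of [f] is bounded and has a limit [y] that
    maximizes [f]. Comparing with [x] gives the growth of the distance; expanding [f z <= f y] about
    [y] gives the linear bound of [supergrad_of_linear]. *)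
Lemma exists_prox_step (h : R) x : 0 < h -> exists y, prox_step h x y.
Proof.
move=> h0; pose k : R := (2 * h)^-1.
have k0 : 0 < k by rewrite invr_gt0 mulr_gt0.
have kh : k * h = 2^-1 by rewrite /k invfM -mulrA mulVf ?gt_eqF // mulr1.
pose f z := dist_set A z - k * enorm (z - x) ^+ 2.
have fle z : f z <= dist_set A x + enorm (z - x) - k * enorm (z - x) ^+ 2.
  by rewrite lerD2r; have := dist_set_lip cA A0 x z; rewrite edistC.
have fx : f x = dist_set A x by rewrite /f subrr enorm0 expr0n /= mulr0 subr0.
pose F := [set f z | z in [set: 'rV[R]_n]].
have fub : has_sup F.
  split; first by exists (f x), x.
  exists (dist_set A x + h) => _ [z _ <-]; apply: le_trans (fle z) _.
  rewrite -addrA lerD2l; set s := enorm _.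
  have : 0 <= k * (s - h) ^+ 2 by rewrite mulr_ge0 ?sqr_ge0 // ltW.
  have -> : k * (s - h) ^+ 2 = k * s ^+ 2 - 2 * (k * h) * s + k * h * h by ring.
  by rewrite kh; lra.
have fM z : f z <= sup F by apply: (ub_le_sup fub.2); exists z.
have hz (j : nat) : exists z, sup F - j.+1%:R^-1 < f z.
  have [|_ [z _ <-] hz] := @sup_adherent _ F j.+1%:R^-1 _ fub; first by rewrite invr_gt0.
  by exists z.
pose u j := projT1 (cid (hz j)); 
have uP j : sup F - j.+1%:R^-1 < f (u j) := projT2 (cid (hz j)).
have [y uy] : exists y, vcvg u y.
  (* Completing the square at [2 * h] bounds [f] by [dist_set A x + 2 * h - s], where [s] is the
     distance to [x], while the sequence keeps [f] above [dist_set A x - 1]. *)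
  apply: (@bounded_vcvg _ _ _ (2 * h + 1 + enorm x)) => j.
  rewrite -[u j](subrK x) (le_trans (enormD _ _)) // lerD2r.
  have := uP j; have := fle (u j); have := fM x; rewrite fx.
  have : j.+1%:R^-1 <= 1 :> R by rewrite invf_le1 ?ler1n.
  set s := enorm _ => h1 h2 h3 h4.
  have : 0 <= k * (s - 2 * h) ^+ 2 by rewrite mulr_ge0 ?sqr_ge0 // ltW.
  have -> : k * (s - 2 * h) ^+ 2 = k * s ^+ 2 - 4 * (k * h) * s + 4 * (k * h) * h by ring.
  by rewrite kh; move: (j.+1%:R^-1) h1 h4 => q; lra.
have fy z : f z <= f y.
  apply: le_trans (fM z) _.
  apply: (@le_lim_omega _ (fun j => sup F - j.+1%:R^-1) (fun j => f (u j))).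
  - by rewrite -[X in _ --> X]subr0; apply: cvgB; [exact: cvg_cst|exact: harmonic_omega].
  - have ux : vcvg (fun j => u j - x) (y - x) by apply: vcvgB uy _; exact: vcvg_cst.
    rewrite /f expr2; apply: cvgB; first exact: cvg_dist_set.
    by apply: cvgM; [exact: cvg_cst|apply: cvgM; exact: cvg_enorm].
  - by move=> j; exact/ltW/uP.
exists y; split.
  have := fy x; rewrite fx => /le_trans; apply.
  by rewrite gerBl mulr_ge0 ?sqr_ge0 // ltW.
apply: (supergrad_of_linear (C := k)) => z.
have := fy z; rewrite /f.
have -> : enorm (z - x) ^+ 2 = enorm (z - y) ^+ 2 + 2 * dot (z - y) (y - x) + enorm (y - x) ^+ 2.
  by rewrite -enorm_sqrD subrKA.
rewrite dotZl (dotC (y - x)).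
have -> : h^-1 = 2 * k by rewrite /k invfM mulrA divff ?mul1r // pnatr_eq0.
by lra.
Qed.

(** Add the two bounds, each tested at the other point: [dot (x - x') (y - y')] is at least
    [(1 - h / a) * edist y y' ^ 2], and Cauchy-Schwarz applies. The hypotheses are linear bounds
    rather than [prox_step] because the lemma is used with the distance to [K] for steps built from
    its offset. *)
Lemma prox_step_contract (h a : R) x y x' y' : 0 < h -> h < a ->
  (forall z, dist_set A z <= dist_set A y + dot (h^-1 *: (y - x)) (z - y)
     + (2 * a)^-1 * enorm (z - y) ^+ 2) ->
  (forall z, dist_set A z <= dist_set A y' + dot (h^-1 *: (y' - x')) (z - y')
     + (2 * a)^-1 * enorm (z - y') ^+ 2) ->
  (1 - h / a) * edist y y' <= edist x x'.
Proof.
move=> h0 ha /(_ y') h1 /(_ y) h2; have a0 := lt_trans h0 ha.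
have [->|yy] := eqVneq y y'; first by rewrite edist0 mulr0 edist_ge0.
have e0 : 0 < edist y y'.
  by rewrite lt_def edist_ge0 andbT; apply: contraNneq yy => /edist_eq0 ->.
have hi0 : 0 < h^-1 by rewrite invr_gt0.
have ha1 : h * h^-1 = 1 by rewrite divff ?gt_eqF.
have E1 : enorm (y' - y) = edist y y' by rewrite edistC.
move: h1 h2; rewrite -(opprB y y') enormN dotNr !dotZl -/(edist y y').
have -> : (2 * a)^-1 = 2^-1 * a^-1 by rewrite invfM.
have := dot_le_enorm (x - x') (y - y'); rewrite -/(edist x x') -/(edist y y').
have -> : dot (x - x') (y - y') = edist y y' ^+ 2 - (dot (y - x) (y - y') - dot (y' - x') (y - y')).
  rewrite /edist enorm_sqr -!dotBl; congr dot.
  by rewrite opprB opprB addrACA; apply/rowP => i; rewrite !mxE; lra.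
set P := dot (y - x) _; set Q := dot (y' - x') _.
set E := edist y y' in e0 *; set X := edist x x' => h3 h1 h2.
have {h1 h2} h4 : h^-1 * (P - Q) <= a^-1 * E ^+ 2 by lra.
have {h4} h4 : P - Q <= h * a^-1 * E ^+ 2.
  have : h * (h^-1 * (P - Q)) <= h * (a^-1 * E ^+ 2) by rewrite ler_pM2l.
  by rewrite !mulrA ha1 mul1r.
by rewrite -(ler_pM2r e0); rewrite !expr2 in h3 h4; lra.
Qed.

(** Test the bound at the starting point, [x = y - h *: xi]. *)
Lemma prox_step_gain (h a : R) x y : 0 < h ->
  (forall z, dist_set A z <= dist_set A y + dot (h^-1 *: (y - x)) (z - y)
     + (2 * a)^-1 * enorm (z - y) ^+ 2) ->
  dist_set A x + h * (1 - h / (2 * a)) * enorm (h^-1 *: (y - x)) ^+ 2 <= dist_set A y.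
Proof.
move=> h0 /(_ x); set xi := h^-1 *: (y - x).
have -> : x - y = - (h *: xi) by rewrite scalerA divff ?gt_eqF // scale1r opprB.
by rewrite enormN (enormZ _ (ltW h0)) dotNr dotZr -enorm_sqr exprMn; lra.
Qed.

(** By [supergrad_enorm_le], the slope [h^-1 *: (y - x)] has norm at most 1. *)
Lemma prox_step_edist (h : R) x y : 0 < h -> 0 < dist_set A y ->
  prox_step h x y -> edist x y <= h.
Proof.
move=> h0 y0 [_ /(supergrad_enorm_le A0)].
rewrite (enormZ _ (dA_ge0 y)) ger_pMr // enormZ; last by rewrite invr_ge0 ltW.
by rewrite ler_pdivrMl // mulr1 edistC.
Qed.

(* The implicit step makes this exact: with [s = h / dist_set A y], the gain of
   [dist_set A ^ 2] is at least [(2 s - s ^ 2) |eta| ^ 2], while [(1 - s) |eta| <= |xi|]. *)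
Lemma prox_step_FK (h l : R) x y : 0 < h -> h <= l -> l <= FK A x -> prox_step h x y ->
  l <= FK A y.
Proof.
move=> h0 hl lF [xy sy]; have l0 := lt_le_trans h0 hl.
have /(le_FK_supergrad cA A0 _ (ltW l0))[xi sx lx] := lF.
set eta := dist_set A y *: _ in sy.
apply/(le_FK_supergrad cA A0 _ (ltW l0)); exists eta => //; apply: le_trans lx _.
(* Together with [h <= l] this yields [s <= 1] below, without which [(1 - s) * enorm eta] could not
   be squared. *)
have lx : l <= dist_set A x.
  rewrite -(@ler_pXn2r _ 2) ?nnegrE // ?(ltW l0) //.
  have /(le_FK_supergrad cA A0 _ (ltW l0))[G _ h1] := lF.
  by have := sqr_ge0 (enorm G); lra.
have y0 : 0 < dist_set A y by apply: lt_le_trans xy; apply: lt_le_trans lx.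
pose s := h / dist_set A y.
have s0 : 0 < s by rewrite divr_gt0.
have s1 : s <= 1 by rewrite ler_pdivrMr // mul1r (le_trans hl) // (le_trans lx).
have yx : y - x = s *: eta.
  by rewrite /s !scalerA divfK ?gt_eqF // divff ?gt_eqF // scale1r.
clearbody eta s; have := supergrad_monotone sx sy.
have := sy x; rewrite -(opprB y x) enormN dotNr yx !dotZr (enormZ _ (ltW s0)) exprMn.
rewrite dotBl -enorm_sqr => h1 h2.
have E0 := enorm_ge0 eta; have X0 := enorm_ge0 xi.
have CS := dot_le_enorm xi eta.
have h3 : (1 - s) * enorm eta ^+ 2 <= dot xi eta.
  by rewrite -(ler_pM2l s0); move: h2; rewrite !expr2; lra.
have h4 : (1 - s) * enorm eta <= enorm xi.
  have [->|e0] := eqVneq (enorm eta) 0; first by rewrite mulr0.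
  have e1 : 0 < enorm eta by rewrite lt_def e0.
  by rewrite -(ler_pM2r e1); move: h3; rewrite expr2; lra.
have : ((1 - s) * enorm eta) ^+ 2 <= enorm xi ^+ 2.
  by apply: lerXn2r; rewrite ?nnegrE // mulr_ge0 // subr_ge0.
by move: h1; rewrite exprMn !expr2; lra.
Qed.
End ProximalStep.

(** * Comparing the distance to [K] with the distance to its offset *)

Section Offset.
Variables (R : realType) (n : nat) (K : set 'rV[R]_n) (alpha : R).
Hypotheses (cK : eclosed K) (K0 : K !=set0) (alpha0 : 0 < alpha).
Let A := offset K alpha.

Lemma eclosed_offset : eclosed A.
Proof.
move=> x hx; apply/ler_addgt0Pr => e e0; have [y Ay xy] := hx e e0.
apply: le_trans (dist_set_lip cK K0 y x) _.
by apply: lerD => //; rewrite edistC ltW.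
Qed.

Lemma offset_neq0 : A !=set0.
Proof.
have [p Kp] := K0; exists p; apply: le_trans (dist_set_le p Kp) _.
by rewrite edist0 ltW.
Qed.

Let cA := eclosed_offset.
Let A0 := offset_neq0.

Lemma dist_set_le_offset x : dist_set K x <= dist_set A x + alpha.
Proof.
have [q [Aq <-]] := Theta_neq0 cA A0 x.
by have := dist_set_lip cK K0 q x; rewrite edistC; move: Aq; rewrite /A /offset /=; lra.
Qed.

(** On the segment from a nearest point [p] to [x], the point at distance [alpha] from [p] lies in
    the offset. *)
Lemma dist_set_offset x : alpha < dist_set K x -> dist_set K x = dist_set A x + alpha.
Proof.
move=> ax; apply/eqP; rewrite eq_le dist_set_le_offset /= -lerBrDr.
have [p [Kp xp]] := Theta_neq0 cK K0 x; set d := dist_set K x in ax xp *.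
have d0 := lt_trans alpha0 ax.
pose s := alpha / d.
have s0 : 0 <= s by rewrite divr_ge0 ?ltW.
have s1 : 0 <= 1 - s by rewrite subr_ge0 ler_pdivrMr // mul1r ltW.
have sd : s * d = alpha by rewrite divfK ?gt_eqF.
pose q := p + s *: (x - p).
have Aq : A q.
  apply: le_trans (dist_set_le _ Kp) _.
  by rewrite /edist /q addrAC subrr add0r (enormZ _ s0) -/(edist x p) xp sd.
apply: le_trans (dist_set_le _ Aq) _; rewrite /edist.
have -> : x - q = (1 - s) *: (x - p).
  by rewrite scalerBl scale1r /q opprD addrA.
by rewrite (enormZ _ s1) -/(edist x p) xp mulrBl mul1r sd.
Qed.

Lemma notin_offset x : 0 < dist_set A x <-> alpha < dist_set K x.
Proof.
split=> [x0|ax]; last by have := dist_set_offset ax; lra.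
rewrite ltNge; apply/negP => Ax.
by have := dist_set_le x (Ax : A x); rewrite edist0; lra.
Qed.

(** [dist_set K] is at most [dist_set A + alpha] everywhere, with equality at [y], so a linear upper
    bound at [y] transfers with the same slope. *)
Lemma supergrad_offset y xi : alpha < dist_set K y ->
  supergrad A y (dist_set A y *: xi) -> supergrad K y (dist_set K y *: xi).
Proof.
move=> ay sg; have y0 : 0 < dist_set A y by apply/notin_offset.
apply: (supergrad_of_linear cK K0 (C := (2 * dist_set A y)^-1)) => z.
have := linear_of_supergrad y0 (lexx _) sg z.
by have := dist_set_le_offset z; rewrite (dist_set_offset ay); lra.
Qed.

(** The distance to the offset may be arbitrarily small along the flow, but the distance to [K]
    exceeds [alpha]; measuring with [K] therefore gives a uniform semiconcavity constant. *)
Lemma prox_step_linear (h : R) x y : alpha < dist_set K x -> prox_step A h x y ->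
  forall z, dist_set K z <= dist_set K y + dot (h^-1 *: (y - x)) (z - y)
     + (2 * alpha)^-1 * enorm (z - y) ^+ 2.
Proof.
move=> ax [xy sg]; have ay : alpha < dist_set K y.
  by apply/notin_offset; apply: lt_le_trans xy; apply/notin_offset.
by apply: linear_of_supergrad (ltW ay) (supergrad_offset ay sg).
Qed.
End Offset.

(** * Finite chains, paths and their lengths *)

Section Chains.
Variables (R : realType) (n : nat).
Implicit Types (A B : set 'rV[R]_n) (x y z : 'rV[R]_n) (e l L : R) (g : R -> 'rV[R]_n).

Inductive chain A e : 'rV[R]_n -> 'rV[R]_n -> R -> Prop :=
| chain_nil x : A x -> chain A e x x 0
| chain_cons x y z l : A x -> edist x y <= e -> chain A e y z l ->
    chain A e x z (edist x y + l).

Lemma chain_ge0 A e x z l : chain A e x z l -> 0 <= l.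
Proof. by elim=> // *; rewrite addr_ge0 ?edist_ge0. Qed.

Lemma chain_head A e x z l : chain A e x z l -> A x.
Proof. by case. Qed.

Lemma chain_cat A e x y z l l' :
  chain A e x y l -> chain A e y z l' -> chain A e x z (l + l').
Proof.
by elim=> [u _|u v w k Au uv _ IH /IH]; rewrite ?add0r // -addrA; exact: chain_cons.
Qed.

Lemma chain_step A e x y : A x -> A y -> edist x y <= e -> chain A e x y (edist x y).
Proof. by move=> Ax Ay xy; rewrite -[edist x y]addr0; apply: chain_cons => //; exact: chain_nil. Qed.

Lemma chain_rev A e x z l : chain A e x z l -> chain A e z x l.
Proof.
elim=> [u|u v w k Au uv vw wv]; first exact: chain_nil.
rewrite addrC; apply: chain_cat wv _.
by rewrite edistC; apply: chain_step => //; [exact: chain_head vw|rewrite edistC].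
Qed.

Lemma chain_weaken A e e' x z l : e <= e' -> chain A e x z l -> chain A e' x z l.
Proof.
move=> ee'; elim=> [u|u v w k Au uv _ IH]; first exact: chain_nil.
by apply: chain_cons IH => //; exact: le_trans ee'.
Qed.

Lemma chain_map A B e c x z l (f : 'rV[R]_n -> 'rV[R]_n) : 0 <= c ->
  (forall y, A y -> B (f y)) ->
  (forall y y', A y -> A y' -> edist (f y) (f y') <= c * edist y y') ->
  chain A e x z l -> exists2 l', l' <= c * l & chain B (c * e) (f x) (f z) l'.
Proof.
move=> c0 fAB flip; elim=> [u Au|u v w k Au uv vw [l' l'k IH]].
  by exists 0; [rewrite mulr0|apply/chain_nil/fAB].
have Av := chain_head vw; exists (edist (f u) (f v) + l').
  by rewrite mulrDr lerD // flip.
apply: chain_cons IH; first exact: fAB.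
by apply: le_trans (flip _ _ Au Av) _; exact: ler_wpM2l.
Qed.

(** The parametrization waits at each vertex and then jumps, so it never leaves [A]. If [s] falls in
    the first step and [t] after it, the carried bound [edist x (g t) <= t] suffices, since [s] is
    less than that step, hence than [e]. *)
Lemma chain_param A e x z l : 0 <= e -> chain A e x z l -> exists g,
  [/\ g 0 = x, g l = z, (forall t, 0 <= t <= l -> A (g t) /\ edist x (g t) <= t) &
      forall s t, 0 <= s -> s <= t -> t <= l -> edist (g s) (g t) <= t - s + e].
Proof.
move=> e0; elim=> [u Au|u v w k Au uv vw [g [g0 gl gA glip]]].
  exists (fun=> u); split=> // [t /andP[t0 _]|s t s0 st t0]; rewrite edist0 //.
  by rewrite addr_ge0 // subr_ge0.
have k0 := chain_ge0 vw; set d := edist u v in uv *.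
have d0 : 0 <= d := edist_ge0 _ _.
exists (fun t => if t < d then u else g (t - d)); split=> [||t /andP[t0 tl]|s t s0 st tl].
- case: ltP => // dle; have d00 : d = 0 by lra.
  by rewrite d00 subr0 g0; apply/esym/edist_eq0.
- by rewrite ltNge lerDl k0 /= addrAC subrr add0r.
- case: ltP => dt; first by rewrite edist0.
  have [|At vt] := gA (t - d); first by apply/andP; split; lra.
  by split=> //; have := edist_triangle v u (g (t - d)); rewrite -/d; lra.
- have [td|dt] := ltP t d; first by rewrite (le_lt_trans st td) edist0; lra.
  have [sd|ds] := ltP s d; last by have := glip (s - d) (t - d); lra.
  have [|_ vt] := gA (t - d); first by apply/andP; split; lra.
  by have := edist_triangle v u (g (t - d)); rewrite -/d; lra.
Qed.

Lemma vcvg_unique (u : nat -> 'rV[R]_n) x y : vcvg u x -> vcvg u y -> x = y.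
Proof.
move=> ux uy; apply: edist_eq0; apply/eqP; rewrite eq_le edist_ge0 andbT.
by apply: le_lim_omega (cvg_edist ux uy) (cvg_cst 0) _ => k; rewrite edist0.
Qed.

Lemma partition_bounds (k : nat) (t : nat -> R) : t 0%N = 0 -> t k = 1 ->
  (forall i, (i < k)%N -> t i <= t i.+1) -> forall i, (i <= k)%N -> 0 <= t i <= 1.
Proof.
move=> t0 tk tm; have mono i j : (i <= j)%N -> (j <= k)%N -> t i <= t j.
  move=> ij; rewrite -(subnKC ij); elim: (j - i)%N => [|m IH]; first by rewrite addn0.
  rewrite addnS => mk; exact: le_trans (IH (ltnW mk)) (tm _ mk).
by move=> i ik; rewrite -t0 -tk !mono.
Qed.

Lemma plength_lipschitz g L :
  (forall s t, 0 <= s -> s <= t -> t <= 1 -> edist (g s) (g t) <= L * (t - s)) ->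
  (plength g <= L%:E)%E.
Proof.
move=> glip; apply: ge_ereal_sup => _ [_ [k [t [t0 tk tm ->]]] <-].
rewrite lee_fin; have tb := partition_bounds t0 tk tm.
apply: (@le_trans _ _ (\sum_(i < k) L * (t i.+1 - t i))).
  apply: ler_sum => i _; rewrite edistC; have /andP[ti0 _] := tb i (ltnW (ltn_ord i)).
  have /andP[_ ti1] := tb i.+1 (ltn_ord i).
  by apply: glip => //; exact: tm.
rewrite -mulr_sumr -(big_mkord xpredT (fun i => t i.+1 - t i)) telescope_sumr //.
by rewrite t0 tk subr0 mulr1.
Qed.

Lemma plength_ge0 g : (0 <= plength g)%E.
Proof.
apply: (@le_trans _ _ (edist (g 1) (g 0))%:E); first by rewrite lee_fin edist_ge0.
apply: ereal_sup_ubound; exists (edist (g 1) (g 0)) => //.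
exists 1%N, (fun i => i%:R); split=> // [i _|]; first by rewrite ler_nat.
by rewrite big_ord1.
Qed.

Lemma gdist_ge0 A x y : (0 <= gdist A x y)%E.
Proof. by apply: le_ereal_inf_tmp => _ [g _ <-]; exact: plength_ge0. Qed.

(* Arzela-Ascoli: the chains, parametrized proportionally to length, are Lipschitz
   up to an error that vanishes in the limit. *)
Lemma chain_limit_path A x z L : eclosed A -> ebounded A -> 0 <= L ->
  (forall e, 0 < e -> exists2 l, l <= L + e & chain A e x z l) ->
  exists2 g, is_path A g x z & (plength g <= L%:E)%E.
Proof.
move=> cA [M MA] L0 h.
pose e (k : nat) : R := k.+1%:R^-1.
have e0 k : 0 < e k by rewrite invr_gt0.
have el : e @ omega --> (0 : R) := @harmonic_omega R.
have hf k : exists g : R -> 'rV[R]_n, [/\ g 0 = x, g 1 = z, (forall t, 0 <= t <= 1 -> A (g t)) &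
    forall s t, 0 <= s -> s <= t -> t <= 1 -> edist (g s) (g t) <= (L + e k) * (t - s) + e k].
  have [l lL c] := h _ (e0 k); have l0 := chain_ge0 c.
  have [g [g0 gl gA glip]] := chain_param (ltW (e0 k)) c.
  exists (fun t => g (l * t)); split=> [||t /andP[t0 t1]|s t s0 st t1].
  - by rewrite mulr0.
  - by rewrite mulr1.
  - by have [] := gA (l * t); rewrite ?mulr_ge0 //= ler_piMr.
  - have t0 := le_trans s0 st.
    apply: le_trans (glip _ _ _ _ _) _; rewrite ?mulr_ge0 ?ler_wpM2l ?ler_piMr //.
    by rewrite lerD2r -mulrBr ler_wpM2r // subr_ge0.
pose f k := projT1 (cid (hf k)).
have fP k : [/\ f k 0 = x, f k 1 = z, (forall t, 0 <= t <= 1 -> A (f k t)) &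
    forall s t, 0 <= s -> s <= t -> t <= 1 -> edist (f k s) (f k t) <= (L + e k) * (t - s) + e k].
  exact: projT2 (cid (hf k)).
(* One ultrafilter gives limits at all times at once, so no dense set of times or diagonal
   extraction is involved. *)
have hg t : exists y, 0 <= t <= 1 -> vcvg (fun k => f k t) y.
  have [t01|] := boolP (0 <= t <= 1); last by exists x.
  have [|y fy] := @bounded_vcvg _ _ (fun k => f k t) M; last by exists y.
  by move=> k; apply: MA; have [_ _ /(_ t t01)] := fP k.
pose g t := projT1 (cid (hg t)).
have gP t : 0 <= t <= 1 -> vcvg (fun k => f k t) (g t) := projT2 (cid (hg t)).
have glip s t : 0 <= s -> s <= t -> t <= 1 -> edist (g s) (g t) <= L * (t - s).
  move=> s0 st t1.
  have gs : vcvg (fun k => f k s) (g s) by apply: gP; rewrite s0 (le_trans st).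
  have gt : vcvg (fun k => f k t) (g t) by apply: gP; rewrite t1 (le_trans s0).
  apply: (le_lim_omega (v := fun k => (L + e k) * (t - s) + e k) (cvg_edist gs gt)).
    have -> : L * (t - s) = (L + 0) * (t - s) + 0 by rewrite !addr0.
    by apply: cvgD (el); apply: cvgM; [apply: cvgD el; exact: cvg_cst|exact: cvg_cst].
  by move=> k; have [_ _ _] := fP k; exact.
exists g; last exact: plength_lipschitz.
split; [|split; [|split]].
- have g0 : vcvg (fun k => f k 0) (g 0) by apply: gP; rewrite lexx ler01.
  apply: vcvg_unique g0 _; have -> : (fun k => f k 0) = fun=> x; last exact: vcvg_cst.
  by apply/funext => k; have [] := fP k.
- have g1 : vcvg (fun k => f k 1) (g 1) by apply: gP; rewrite lexx ler01.
  apply: vcvg_unique g1 _; have -> : (fun k => f k 1) = fun=> z; last exact: vcvg_cst.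
  by apply/funext => k; have [] := fP k.
- move=> t t01; apply: eclosed_vcvg cA (gP t t01) _ => k.
  by have [_ _ /(_ t t01)] := fP k.
(* Dividing by [L + 1] instead of [L] covers [L = 0]. *)
- move=> t /andP[t0 t1] d d0; have L1 : 0 < L + 1 by lra.
  exists (d / (L + 1)); first by rewrite divr_gt0.
  move=> s /andP[s0 s1]; rewrite ltr_pdivlMr // => st.
  apply: le_lt_trans st; rewrite mulrC; apply: (@le_trans _ _ (L * `|s - t|)); last first.
    by rewrite ler_wpM2r // lerDl.
  have [s_t|/ltW t_s] := leP s t; last by rewrite edistC ger0_norm ?subr_ge0 // glip.
  by rewrite distrC ger0_norm ?subr_ge0 // glip.
Qed.

(** Sample at equal subdivisions; the chain length is then one of the partition sums. If no
    subdivision were fine enough, the offending pairs of consecutive times would converge along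
    [omega] to a common time, contradicting continuity there. *)
Lemma path_chain A g x z L e : is_path A g x z -> (plength g <= L%:E)%E -> 0 < e ->
  exists2 l, l <= L & chain A e x z l.
Proof.
move=> [g0 [g1 [gA gc]]] gL e0.
have [m small] : exists m : nat, forall i, (i < m.+1)%N ->
    edist (g (i%:R / m.+1%:R)) (g (i.+1%:R / m.+1%:R)) <= e.
  apply: contrapT => hn.
  have h (m : nat) : exists i : nat, (i < m.+1)%N /\
      e < edist (g (i%:R / m.+1%:R)) (g (i.+1%:R / m.+1%:R)).
    apply: contrapT => hm; apply: hn; exists m => i im; rewrite leNgt; apply/negP => ei.
    by apply: hm; exists i.
  pose i m := projT1 (cid (h m)).
  have iP m : (i m < m.+1)%N /\ e < edist (g ((i m)%:R / m.+1%:R)) (g ((i m).+1%:R / m.+1%:R)).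
    exact: projT2 (cid (h m)).
  pose u m : R := (i m)%:R / m.+1%:R; pose v m : R := (i m).+1%:R / m.+1%:R.
  have ub m : 0 <= u m <= 1.
    by rewrite divr_ge0 //= ler_pdivrMr ?mul1r ?ler_nat ?ltr0n // ltnW // (iP m).1.
  have vb m : 0 <= v m <= 1.
    by rewrite divr_ge0 //= ler_pdivrMr ?mul1r ?ler_nat ?ltr0n // (iP m).1.
  have [t ut] := bounded_cvg_omega ub.
  have vt : v @ omega --> t.
    rewrite -[t]addr0; have -> : v = fun m => u m + m.+1%:R^-1.
      by apply/funext => m; rewrite /u /v -natr1 mulrDl mul1r.
    by apply: cvgD ut _; exact: harmonic_omega.
  have t01 : 0 <= t <= 1.
    apply/andP; split.
      by apply: (@le_lim_omega _ (fun=> 0)) ut _; [exact: cvg_cst|move=> m; have /andP[] := ub m].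
    by apply: (@le_lim_omega _ _ (fun=> 1)) (ut) _ _; [exact: cvg_cst|move=> m; have /andP[] := ub m].
  have [d d0 hd] := gc t t01 (e / 2) (divr_gt0 e0 (ltr0Sn _ _)).
  have nu : \forall m \near omega, `|t - u m| < d by move/cvgrPdist_lt: ut; exact.
  have nv : \forall m \near omega, `|t - v m| < d by move/cvgrPdist_lt: vt; exact.
  have [m [um vm]] := filter_ex (filterI nu nv).
  have := hd _ (ub m); rewrite distrC => /(_ um) h1.
  have := hd _ (vb m); rewrite distrC => /(_ vm) h2.
  have := (iP m).2; rewrite -/(u m) -/(v m).
  by have := edist_triangle (g t) (g (u m)) (g (v m)); rewrite (edistC (g t)); lra.
pose t (i : nat) : R := i%:R / m.+1%:R.
have tA i : (i <= m.+1)%N -> A (g (t i)).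
  by move=> im; apply: gA; rewrite divr_ge0 //= ler_pdivrMr ?mul1r ?ler_nat ?ltr0n.
have t0 : t 0%N = 0 by rewrite /t mul0r.
have t1 : t m.+1 = 1 by rewrite /t divff // pnatr_eq0.
exists (\sum_(i < m.+1) edist (g (t i.+1)) (g (t i))).
  rewrite -lee_fin; apply: le_trans gL; apply: ereal_sup_ubound.
  exists (\sum_(i < m.+1) edist (g (t i.+1)) (g (t i))) => //.
  exists m.+1, t; split=> // i _.
  by rewrite ler_pM2r ?invr_gt0 ?ltr0n // ler_nat.
have -> : x = g (t 0%N) by rewrite t0 g0.
have -> : z = g (t m.+1) by rewrite t1 g1.
suff H j : (j <= m.+1)%N -> chain A e (g (t 0%N)) (g (t j)) (\sum_(i < j) edist (g (t i.+1)) (g (t i))).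
  exact: H.
elim: j => [|j IH] jm; first by rewrite big_ord0; apply/chain_nil/tA.
rewrite big_ord_recr /= edistC; apply: chain_cat (IH (ltnW jm)) _.
by apply: chain_step; [apply/tA/ltnW|exact: tA|exact: small].
Qed.

(** Nearly minimizing paths yield chains of arbitrarily small mesh, and [chain_limit_path] turns
    these into a path no longer than the infimum. *)
Lemma exists_minimal_path A x z : eclosed A -> ebounded A -> (gdist A x z < +oo)%E ->
  exists2 g, is_path A g x z & plength g = gdist A x z.
Proof.
move=> cA bA; case D : (gdist A x z) => [d| |] // _; last first.
  by have := gdist_ge0 A x z; rewrite D.
have d0 : 0 <= d by rewrite -lee_fin -D gdist_ge0.
have [e e0|g gp gL] := chain_limit_path (x := x) (z := z) cA bA d0.
  have [|_ [g gp <-] gd] := @lb_ereal_inf_adherent _ [set plength g | g in [set g | is_path A g x z]] _ e0.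
    by rewrite -/(gdist A x z) D.
  rewrite -/(gdist A x z) D -EFinD in gd.
  by have [l ll c] := path_chain gp (ltW gd) e0; exists l.
exists g => //; apply/eqP; rewrite eq_le gL -D /=.
by apply: ereal_inf_lbound; exists g.
Qed.
End Chains.

(** The supergradients attached by [le_FK_supergrad] to points tending to [x] are bounded by the
    distance, and a limit of them is a witness at [x]. *)
Lemma eclosed_ax (R : realType) (n : nat) (A : set 'rV[R]_n) (l : R) :
  eclosed A -> A !=set0 -> 0 <= l -> eclosed [set x | l <= FK A x].
Proof.
move=> cA A0 l0 x hx.
have hy (k : nat) : exists y, l <= FK A y /\ edist x y < k.+1%:R^-1.
  by have [|y] := hx k.+1%:R^-1; [rewrite invr_gt0|exists y].
pose y k := projT1 (cid (hy k)).
have yP k : l <= FK A (y k) /\ edist x (y k) < k.+1%:R^-1 := projT2 (cid (hy k)).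
have yx : vcvg y x.
  apply: vcvg_edist; apply: (@squeeze_cvgr _ _ _ _ (fun=> 0) (fun k => k.+1%:R^-1)).
  - by apply: filterE => k; rewrite edist_ge0 edistC ltW // (yP k).2.
  - exact: cvg_cst.
  - exact: harmonic_omega.
have he k : exists eta, supergrad A (y k) eta /\ l ^+ 2 <= dist_set A (y k) ^+ 2 - enorm eta ^+ 2.
  by have /(le_FK_supergrad cA A0 _ l0)[eta] := (yP k).1; exists eta.
pose eta k := projT1 (cid (he k)).
have etaP k : supergrad A (y k) (eta k) /\ l ^+ 2 <= dist_set A (y k) ^+ 2 - enorm (eta k) ^+ 2.
  exact: projT2 (cid (he k)).
have [xi ex] : exists xi, vcvg eta xi.
  apply: (@bounded_vcvg _ _ _ (dist_set A x + 1)) => k.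
  apply: le_trans (supergrad_enorm_le A0 (etaP k).1) _.
  apply: le_trans (dist_set_lip cA A0 x _) _; rewrite lerD2l.
  by apply: le_trans (ltW (yP k).2) _; rewrite invf_le1 ?ler1n.
apply/(le_FK_supergrad cA A0 _ l0); exists xi.
  by apply: supergrad_vcvg yx ex _ => // k; exact: (etaP k).1.
have cd := cvg_dist_set cA A0 yx; have ce := cvg_enorm ex.
apply: (@le_lim_omega _ (fun=> l ^+ 2)
  (fun k => dist_set A (y k) ^+ 2 - enorm (eta k) ^+ 2)); first exact: cvg_cst.
  by rewrite !expr2; apply: cvgB; apply: cvgM.
by move=> k; exact: (etaP k).2.
Qed.

(** * Pushing the complement of the offset into the medial axis *)

Section Retraction.
Variables (R : realType) (n : nat) (K : set 'rV[R]_n) (mu alpha lambda : R).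
Hypotheses (cK : eclosed K) (K0 : K !=set0) (bK : ebounded (~` K)).
Hypotheses (mu0 : 0 < mu) (alpha0 : 0 < alpha) (lambda0 : 0 < lambda).
Hypothesis hr : ((alpha + lambda)%:E < rmu K mu alpha)%E.
Implicit Types (x y xi : 'rV[R]_n).

Let A := offset K alpha.
Let E := ~` A.
Let AX := ax K lambda alpha.
Let mt := mutilde K mu lambda alpha alpha.
Let Rm := Rmax K.
Let cA : eclosed A := eclosed_offset cK K0.
Let A0 : A !=set0 := offset_neq0 K0 alpha0.

Lemma compl_offsetE x : E x <-> alpha < dist_set K x.
Proof. by rewrite ltNge; split=> [/negP|/negP]. Qed.

(** The hypothesis on [rmu] says exactly that [lambda / (r - alpha)] is less than 1. *)
Lemma mutilde_gt0 : 0 < mt.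
Proof.
rewrite /mt /mutilde; case: rmu hr => [r| |] //; rewrite lte_fin => hr'.
have ra : 0 < r - alpha by rewrite subr_gt0 (lt_trans _ hr') // ltrDl.
rewrite lt_min mu0 sqrtr_gt0 subr_gt0 expr_lt1 ?divr_ge0 ?(ltW lambda0) ?(ltW ra) //.
by rewrite ltr_pdivrMr // mul1r ltrBrDl.
Qed.

Lemma ax_sub_compl x : AX x -> E x.
Proof.
move=> /(le_FK_supergrad cA A0 _ (ltW lambda0))[eta _ h].
apply/compl_offsetE/(notin_offset cK K0 alpha0); rewrite lt_def (dist_set_ge0 A0) andbT.
apply/eqP => d0; move: h; rewrite -/A d0 expr0n /= sub0r.
have : 0 < lambda ^+ 2 by rewrite exprn_gt0.
by have := sqr_ge0 (enorm eta); lra.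
Qed.

Lemma dist_set_le_Rmax x : E x -> dist_set K x <= Rm.
Proof.
move=> /compl_offsetE ax; have Kx : ~ K x.
  by move=> Kx; have := dist_set_le x Kx; rewrite edist0 leNgt (lt_trans alpha0 ax).
have [M MK] := bK; have [k Kk] := K0; apply: ub_le_sup; last by exists x.
exists (M + enorm k) => _ [z Kz <-]; apply: le_trans (dist_set_le z Kk) _.
by rewrite /edist -[enorm k]enormN (le_trans (enormD _ _)) // lerD2r MK.
Qed.

Lemma enorm_gradK_ge x : E x -> ((dist_set K x)%:E < rmu K mu alpha)%E ->
  mu <= enorm (gradK K x).
Proof.
move=> /compl_offsetE ax; rewrite ltNge => /negP xr; rewrite leNgt; apply/negP => gx.
apply: xr; apply: ereal_inf_lbound; exists (dist_set K x) => //; split=> //.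
rewrite /chi; cbv zeta; set S := [set enorm _ | _ in _].
have Sx : S !=set0 by exists (enorm (gradK K x)), x.
case: (pselect (S !=set0)) => //= _.
apply: (le_lt_trans _ gx); apply: ge_inf; last by exists x.
by exists 0 => _ [y _ <-]; exact: enorm_ge0.
Qed.

(** Below the level [rmu], the slope is at least the norm of [gradK], by minimality of the centered
    supergradient. From that level on, the distance to the offset is at least [r - alpha], and a
    smaller slope would put [y] on the axis. *)
Lemma mutilde_le_slope y xi : E y -> supergrad A y (dist_set A y *: xi) -> ~ AX y ->
  mt <= enorm xi.
Proof.
move=> Ey sy nax; have /compl_offsetE ay := Ey.
have y0 : 0 < dist_set A y by apply/(notin_offset cK K0 alpha0).
have dE : dist_set K y = dist_set A y + alpha by exact: dist_set_offset.
have low : ((dist_set K y)%:E < rmu K mu alpha)%E -> mu <= enorm xi.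
  move=> /(enorm_gradK_ge Ey) /le_trans; apply.
  have d0 := lt_trans alpha0 ay.
  rewrite enormZ ?invr_ge0 ?(ltW d0) // ler_pdivrMl // -(enormZ _ (ltW d0)).
  exact: (center_enorm_le cK K0 (supergrad_offset cK K0 alpha0 ay sy)).
move: low hr; rewrite /mt /mutilde; case: rmu => [r| |] // low; last first.
  by move=> _; apply: low; rewrite ltry.
rewrite lte_fin => hr'; have [dr|rd] := ltP (dist_set K y) r.
  by rewrite ge_min low // lte_fin.
rewrite ge_min; apply/orP; right; rewrite leNgt; apply/negP => hlt; apply: nax.
have ra : 0 < r - alpha by rewrite subr_gt0 (lt_trans _ hr') // ltrDl.
apply/(le_FK_supergrad cA A0 _ (ltW lambda0)); exists (dist_set A y *: xi) => //.
rewrite (enormZ _ (ltW y0)) exprMn -/A; set q := lambda / (r - alpha) in hlt.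
have q0 : 0 <= q by rewrite divr_ge0 ?(ltW lambda0) ?(ltW ra).
have -> : lambda = q * (r - alpha) by rewrite divfK ?gt_eqF.
(* A norm lies strictly below the root, so the root is not the default value 0 taken at negative
   arguments. *)
have q1 : 0 < 1 - q ^+ 2.
  by rewrite -sqrtr_gt0; apply: le_lt_trans hlt; exact: enorm_ge0.
have x1 : enorm xi ^+ 2 <= 1 - q ^+ 2.
  by rewrite -[leRHS](sqr_sqrtr (ltW q1)) lerXn2r ?nnegrE ?enorm_ge0 ?sqrtr_ge0 ?ltW.
have : (r - alpha) ^+ 2 * q ^+ 2 <= dist_set A y ^+ 2 * q ^+ 2.
  by rewrite ler_wpM2r ?sqr_ge0 // lerXn2r ?nnegrE ?(ltW ra) ?(ltW y0) // lerBlDr -dE.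
have : dist_set A y ^+ 2 * enorm xi ^+ 2 <= dist_set A y ^+ 2 * (1 - q ^+ 2).
  by rewrite ler_wpM2l ?sqr_ge0.
by clearbody q; rewrite exprMn; move: (r - alpha) (dist_set A y) => ? ?; lra.
Qed.

(** * Iterating the proximal step *)

Section Iteration.
Variables (h : R) (P : 'rV[R]_n -> 'rV[R]_n).
Hypotheses (h0 : 0 < h) (ha : h < alpha) (hl : h <= lambda).
Hypothesis PP : forall x, E x -> prox_step A h x (P x).

Let Elin x (Ex : E x) := prox_step_linear cK K0 alpha0 (iffLR (compl_offsetE x) Ex) (PP Ex).

Lemma prox_compl x : E x -> E (P x).
Proof.
move=> Ex; have [xy _] := PP Ex; apply/compl_offsetE/(notin_offset cK K0 alpha0).
by apply: lt_le_trans xy; apply/(notin_offset cK K0 alpha0)/compl_offsetE.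
Qed.

Lemma iter_prox_compl k x : E x -> E (iter k P x).
Proof. by move=> Ex; elim: k => //= k; exact: prox_compl. Qed.

Lemma prox_ax x : AX x -> AX (P x).
Proof.
move=> xax; have Ex := ax_sub_compl xax.
exact: (prox_step_FK cA A0 h0 hl xax (PP Ex)).
Qed.

Lemma iter_prox_ax k x : AX x -> AX (iter k P x).
Proof. by move=> xax; elim: k => //= k; exact: prox_ax. Qed.

(** Flow lines started on the axis remain on it; they form the two end pieces of the connecting
    chain. *)
Lemma iter_prox_chain k x : AX x ->
  exists2 l, l <= k%:R * h & chain AX h x (iter k P x) l.
Proof.
move=> xax; elim: k => [|k [l lk c]].
  by exists 0; [rewrite mul0r|exact: chain_nil].
have axk := iter_prox_ax k xax; have Ek := ax_sub_compl axk.
have step : edist (iter k P x) (iter k.+1 P x) <= h.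
  apply: prox_step_edist (PP Ek) => //.
  by apply/(notin_offset cK K0 alpha0)/compl_offsetE/prox_compl.
exists (l + edist (iter k P x) (iter k.+1 P x)).
  by rewrite -natr1 mulrDl mul1r lerD.
by apply: chain_cat c _; apply: chain_step => //; exact: iter_prox_ax.
Qed.

Lemma iter_prox_lip k x y : E x -> E y ->
  edist (iter k P x) (iter k P y) <= ((1 - h / alpha)^-1) ^+ k * edist x y.
Proof.
move=> Ex Ey; have c0 : 0 < 1 - h / alpha by rewrite subr_gt0 ltr_pdivrMr // mul1r.
elim: k => [|k IH]; first by rewrite mul1r.
rewrite exprS -mulrA ler_pdivlMl //.
have Exk : E (iter k P x) := iter_prox_compl Ex.
have Eyk : E (iter k P y) := iter_prox_compl Ey.
exact: le_trans (prox_step_contract h0 ha (Elin Exk) (Elin Eyk)) IH.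
Qed.

(** The step preserves the axis, so an iterate off it has only predecessors off it, and every step
    had slope at least [mt]. *)
Lemma iter_prox_gain k x : E x -> ~ AX (iter k P x) ->
  dist_set K x + k%:R * (h * (1 - h / alpha) * mt ^+ 2) <= dist_set K (iter k P x).
Proof.
move=> Ex; elim: k => [|k IH] nax; first by rewrite mul0r addr0.
have Exk : E (iter k P x) := iter_prox_compl Ex.
have nax' : ~ AX (iter k P x) by move=> /prox_ax.
have := prox_step_gain h0 (Elin Exk); set xi := h^-1 *: _.
have [_ sg] := PP Exk.
have slope : mt <= enorm xi.
  by apply: mutilde_le_slope sg nax; exact: prox_compl.
have s2 : mt ^+ 2 <= enorm xi ^+ 2.
  by rewrite lerXn2r ?nnegrE ?enorm_ge0 // ltW // mutilde_gt0.
have c0 : 0 < 1 - h / alpha by rewrite subr_gt0 ltr_pdivrMr // mul1r.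
(* The factor of [prox_step_gain] is weakened to the one that appears in [exists_step]. *)
have cc : 1 - h / alpha <= 1 - h / (2 * alpha).
  by rewrite lerD2l lerN2 ler_pM2l // lef_pV2 ?posrE ?mulr_gt0 // ler_peMl ?(ltW alpha0) ?ler1n.
have : h * (1 - h / alpha) * mt ^+ 2 <= h * (1 - h / (2 * alpha)) * enorm xi ^+ 2.
  apply: ler_pM => //; rewrite ?sqr_ge0 ?mulr_ge0 ?(ltW h0) ?(ltW c0) //.
  by rewrite ler_pM2l.
by have := IH nax'; rewrite -natr1 mulrDl mul1r /=; lra.
Qed.

(** An iterate still off the axis would have gained [Rm - alpha] from a level above [alpha], and so
    exceed [Rm]. *)
Lemma iter_prox_reaches N x : E x ->
  Rm - alpha <= N%:R * (h * (1 - h / alpha) * mt ^+ 2) -> AX (iter N P x).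
Proof.
move=> Ex hN; apply: contrapT => /(iter_prox_gain Ex).
have /compl_offsetE := Ex.
have : E (iter N P x) := iter_prox_compl Ex.
by move=> /dist_set_le_Rmax; lra.
Qed.
End Iteration.

Let T := Rm / mt ^+ 2.

(* The step [h] is tuned so that [(1 - h / alpha)^-1 = 1 + T / (N alpha)], whose
   [N]-th power is at most [expR (T / alpha)]. *)
Lemma exists_step d : 0 < Rm -> 0 < d -> exists N (h : R),
  [/\ 0 < h, h <= d, h < alpha, N%:R * h = T * (1 - h / alpha) &
      ((1 - h / alpha)^-1) ^+ N <= expR (T / alpha)].
Proof.
move=> Rm0 d0; have T0 : 0 < T by rewrite divr_gt0 ?exprn_gt0 ?mutilde_gt0.
move: T T0 => t t0.
have [N Nd] : exists N : nat, t / d < N%:R.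
  by exists (Num.bound (t / d)); apply: archi_boundP; exact: divr_ge0 (ltW t0) (ltW d0).
have N0 : (0 : R) < N%:R by apply: lt_trans Nd; rewrite divr_gt0.
pose D := N%:R * alpha + t; have D0 : 0 < D by rewrite addr_gt0 ?mulr_gt0.
(* Solves [N%:R * h = t * (1 - h / alpha)], which is linear in [h]. *)
pose h := t * alpha / D.
have hD : h * D = t * alpha by rewrite /h divfK ?gt_eqF.
have h0 : 0 < h by rewrite divr_gt0 ?mulr_gt0.
have hN : N%:R * h = t * (1 - h / alpha).
  apply: (mulIf (x := alpha)); first by rewrite gt_eqF.
  by rewrite -[RHS]mulrA mulrBl mul1r divfK ?gt_eqF // mulrBr -hD /D; ring.
have c0 : 0 < 1 - h / alpha by rewrite -(pmulr_rgt0 _ t0) -hN mulr_gt0.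
exists N, h; split=> //.
- move: Nd; rewrite ltr_pdivrMr // => Nd.
  have : N%:R * h <= N%:R * d.
    rewrite hN; apply: le_trans (ltW Nd); rewrite ler_piMr ?(ltW t0) //.
    by rewrite gerBl divr_ge0 ?ltW.
  by rewrite ler_pM2l.
- by move: c0; rewrite subr_gt0 ltr_pdivrMr // mul1r.
- have -> : (1 - h / alpha)^-1 = 1 + t / alpha / N%:R.
    apply: (mulIf (x := 1 - h / alpha)); first by rewrite gt_eqF.
    rewrite mulVf ?gt_eqF // mulrDl mul1r.
    have -> : t / alpha / N%:R * (1 - h / alpha) = alpha^-1 * (N%:R^-1 * (N%:R * h)).
      by rewrite hN; ring.
    by rewrite mulKf ?gt_eqF // [alpha^-1 * h]mulrC subrK.
  have -> : expR (t / alpha) = expR (t / alpha / N%:R) ^+ N.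
    by rewrite -expRM_natr divfK ?gt_eqF.
  apply: lerXn2r; rewrite ?nnegrE ?expR_ge0 ?expR_ge1Dx //.
  by rewrite addr_ge0 // !divr_ge0 ?(ltW t0) ?(ltW alpha0).
Qed.

Lemma ax_chain x x' L e : AX x -> AX x' -> (gdist E x x' <= L%:E)%E -> 0 < e ->
  exists2 l, l <= 2 * T + L * expR (T / alpha) + e & chain AX e x x' l.
Proof.
move=> xax xax' gL e0; have Ex := ax_sub_compl xax.
have Rm0 : 0 < Rm.
  apply: lt_le_trans (dist_set_le_Rmax Ex); apply: lt_trans alpha0 _.
  exact/compl_offsetE.
(* The step is at most [e] for the mesh of the flow chains, [lambda] for [prox_step_FK], and
   [alpha ^ 2 / (2 * Rm)] so that the total gain [Rm * (1 - h / alpha) ^ 2] is still at least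
   [Rm - alpha]. *)
have d0 : 0 < Num.min (Num.min e lambda) (alpha ^+ 2 / (2 * Rm)).
  by rewrite !lt_min e0 lambda0 divr_gt0 ?exprn_gt0 ?mulr_gt0.
have [N [h [h0 + ha hN hX]]] := exists_step Rm0 d0.
rewrite !le_min => /andP[/andP[he hl]] hR.
have hP y : exists z, E y -> prox_step A h y z.
  by have [z yz] := exists_prox_step cA A0 y h0; exists z.
pose P y := projT1 (cid (hP y)).
have PP y : E y -> prox_step A h y (P y) := projT2 (cid (hP y)).
have reach y : E y -> AX (iter N P y).
  move=> Ey; apply: (iter_prox_reaches h0 ha hl PP Ey).
  have -> : N%:R * (h * (1 - h / alpha) * mt ^+ 2) = Rm * (1 - h / alpha) ^+ 2.
    rewrite -[Rm in RHS](divfK (x := mt ^+ 2)); last by rewrite gt_eqF ?exprn_gt0 ?mutilde_gt0.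
    have -> : N%:R * (h * (1 - h / alpha) * mt ^+ 2)
      = N%:R * h * (mt ^+ 2 * (1 - h / alpha)) by ring.
    by rewrite hN /T; ring.
  have hu : 2 * Rm * (h / alpha) <= alpha.
    by rewrite mulrA ler_pdivrMr // mulrC -ler_pdivlMr ?mulr_gt0 // -expr2.
  have : 0 <= Rm * (h / alpha) ^+ 2 by rewrite mulr_ge0 ?sqr_ge0 // ltW.
  by move: (h / alpha) (alpha) Rm hu => *; lra.
set X := expR (T / alpha) in hX *; have X0 : 0 < X := expR_gt0 _.
(* Both the excess length and the mesh are [e / X], and become [e] after the expansion by [X]. *)
have [_ [g gp <-] gl] : exists2 s, [set plength g | g in [set g | is_path E g x x']] s &
    (s < (L + e / X)%:E)%E.
  by apply: ereal_inf_lt; apply: le_lt_trans gL _; rewrite lte_fin ltrDl divr_gt0.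
have [l1 l1L c1] := path_chain gp (ltW gl) (divr_gt0 e0 X0).
have lip y y' : E y -> E y' -> edist (iter N P y) (iter N P y') <= X * edist y y'.
  move=> Ey Ey'; apply: le_trans (iter_prox_lip h0 ha PP N Ey Ey') _.
  by rewrite ler_wpM2r ?edist_ge0.
have [l2 l2l c2] := chain_map (ltW X0) reach lip c1.
have NT : N%:R * h <= T.
  have T0 : 0 < T by rewrite divr_gt0 ?exprn_gt0 ?mutilde_gt0.
  by rewrite hN ler_piMr ?(ltW T0) // gerBl divr_ge0 ?(ltW h0) ?(ltW alpha0).
have [l3 l3T c3] := iter_prox_chain h0 hl PP N xax.
have [l4 l4T c4] := iter_prox_chain h0 hl PP N xax'.
rewrite mulrC divfK ?gt_eqF // in c2.
exists (l3 + (l2 + l4)); last first.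
  apply: chain_cat (chain_weaken he c3) (chain_cat c2 _).
  exact/chain_rev/(chain_weaken he).
have : X * l1 <= X * L + e.
  have -> : X * L + e = X * (L + e / X) by rewrite mulrDr mulrCA divff ?gt_eqF // mulr1.
  by rewrite ler_pM2l.
by move: T NT l3T l4T => *; lra.
Qed.

Lemma ebounded_ax : ebounded AX.
Proof.
have [M MK] := bK; exists M => y /ax_sub_compl /compl_offsetE ay; apply: MK => Ky.
by have := dist_set_le y Ky; rewrite edist0 leNgt (lt_trans alpha0 ay).
Qed.

Lemma gdist_ax_le x x' L : AX x -> AX x' -> (gdist E x x' <= L%:E)%E ->
  (gdist AX x x' <= (2 * T + L * expR (T / alpha))%:E)%E.
Proof.
move=> xax xax' gL.
have [|e e0|g gp gl] := @chain_limit_path _ _ AX x x' (2 * T + L * expR (T / alpha))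
    (eclosed_ax cA A0 (ltW lambda0)) ebounded_ax.
- have L0 : 0 <= L by rewrite -lee_fin; apply: le_trans gL; exact: gdist_ge0.
  have Rm0 : 0 <= Rm.
    apply: le_trans (dist_set_le_Rmax (ax_sub_compl xax)); exact: dist_set_ge0.
  have T0 : 0 <= T by rewrite divr_ge0 // sqr_ge0.
  by apply: addr_ge0; apply: mulr_ge0 => //; exact: expR_ge0.
- exact: ax_chain.
- by apply: le_trans gl; apply: ereal_inf_lbound; exists g.
Qed.
End Retraction.

(** * Shortest paths and geodesic diameter of the medial axis *)

Theorem theorem9p12 (R : realType) (n : nat) (K : set 'rV[R]_n)
  (mu alpha lambda : R) :
  (0 < n)%N ->
  eclosed K -> eopen (~` K) -> ebounded (~` K) ->
  0 < mu -> mu <= 1 -> 0 < alpha -> 0 < lambda ->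
  ((alpha + lambda)%:E < rmu K mu alpha)%E ->
  econnected (~` offset K alpha) ->
  (Gdiam (~` offset K alpha) < +oo)%E ->
  let mt := mutilde K mu lambda alpha alpha in
  let Rm := Rmax K in
  ((Gdiam (ax K lambda alpha) <=
      adde (2 * Rm / mt ^+ 2)%:E
        (Gdiam (~` offset K alpha) * (expR (Rm / (alpha * mt ^+ 2)))%:E))%E /\
  forall x x', ax K lambda alpha x -> ax K lambda alpha x' ->
    exists g : R -> 'rV[R]_n,
      [/\ is_path (ax K lambda alpha) g x x',
          plength g = gdist (ax K lambda alpha) x x' &
          (plength g <= Gdiam (ax K lambda alpha))%E]).
Proof.
move=> n0 cK _ bK mu0 _ alpha0 lambda0 hr _ Gfin mt Rm.
(* If [K] were empty, its complement would be the whole space, which is unbounded since [n] is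
   positive. *)
have K0 : K !=set0.
  apply: contrapT => K0; have [M MK] := bK.
  have nK y : (~` K) y by move=> Ky; apply: K0; exists y.
  have := MK (const_mx (`|M| + 1)) (nK _); rewrite leNgt => /negP; apply.
  apply: lt_le_trans (coord_le_enorm _ (Ordinal n0)); rewrite mxE ger0_norm ?addr_ge0 //.
  by rewrite (le_lt_trans (ler_norm M)) // ltrDl.
set E := ~` offset K alpha in Gfin *; set AX := ax K lambda alpha.
(* An empty supremum is [-oo], so [Gdiam E] is shown to be real only in the presence of points of
   the axis, through nonnegativity of [gdist]. *)
have bound x x' : AX x -> AX x' -> exists G : R, Gdiam E = G%:E /\
    (gdist AX x x' <= (2 * (Rm / mt ^+ 2) + G * expR (Rm / mt ^+ 2 / alpha))%:E)%E.
  move=> xax xax'.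
  have EG : (gdist E x x' <= Gdiam E)%E.
    apply: ereal_sup_ubound; exists x; first exact: (ax_sub_compl cK K0 alpha0 lambda0 xax).
    by exists x' => //; exact: (ax_sub_compl cK K0 alpha0 lambda0 xax').
  have := le_trans (gdist_ge0 E x x') EG; case EGd : (Gdiam E) Gfin EG => [G| |] // _ EG _.
  by exists G; split=> //; exact: gdist_ax_le.
split.
  apply: ge_ereal_sup => _ [x xax [x' xax' <-]]; have [G [-> h]] := bound x x' xax xax'.
  by apply: le_trans h _; rewrite -EFinM /adde /= lee_fin [2 * _]mulrA -[_ / alpha]mulrA -invfM [mt ^+ 2 * _]mulrC.
move=> x x' xax xax'; have [G [_ h]] := bound x x' xax xax'.
have cA := eclosed_offset cK K0 (alpha := alpha); have A0 := offset_neq0 K0 alpha0.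
have [|||g gp gl] := @exists_minimal_path _ _ AX x x'.
- exact: (eclosed_ax cA A0 (ltW lambda0)).
- exact: (ebounded_ax cK K0 bK alpha0 lambda0).
- exact: le_lt_trans h (ltry _).
exists g; split=> //; rewrite gl; apply: ereal_sup_ubound.
by exists x => //; exists x'.
Qed.
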